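(* Let $p$ be a prime, let $a$ be an integer not divisible by $p$ and let $F$ be a natural number divisible by $p$. Define $r$ by $|F|_p=p^{-r}$. Suppose that $$\log F+\sum_{q\mid F}\frac{\log q}{q-1}+1<2r\log p+2\,\frac{\log p}{p-1},$$ where the sum is over all primes $q$ dividing $F$. Then the $p$-adic number $\Theta_p(a/F)$ is irrational, i.e. $\Theta_p(a/F)\in\mathbb{Q}_p\setminus\mathbb{Q}$.
   Context: The Bernoulli numbers $B_n$ are defined by $\frac{t}{e^t-1}=\sum_{n\ge0}B_n\frac{t^n}{n!}$. Put $t_n=(2^{n+1}-2)B_n$. For a prime $p$, an integer $a$ with $p\nmid a$ and a positive integer $F$ with $p\mid F$, the $p$-adic number $\Theta_p(a/F)$ is the sum of the $p$-adically convergent series $$\Theta_p(a/F)=\sum_{n\ge0}t_n\left(-\frac{F}{a}\right)^{n+1}\in\mathbb{Q}_p .$$ $|\cdot|_p$ is the $p$-adic absolute value normalized by $|p|_p=1/p$. *)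

(* Defs.v *)
From HB Require Import structures.
From mathcomp Require Import all_boot all_order all_algebra.
From mathcomp Require Import all_classical all_reals all_analysis.
From mathcomp Require Import generic_quotient ring_quotient.
From mathcomp Require Import ring lra zify.

Set Implicit Arguments.
Unset Strict Implicit.
Unset Printing Implicit Defensive.

Import Order.TTheory GRing.Theory Num.Theory.

Local Open Scope classical_set_scope.
Local Open Scope ring_scope.

(* These make sense for every p; when p is not prime, logn p is constantly 0,
   so padic_abs p is the trivial absolute value. *)
Definition padic_val (p : nat) (x : rat) : int :=
  (logn p `|numq x|%N)%:Z - (logn p `|denq x|%N)%:Z.

Definition padic_abs (p : nat) (x : rat) : rat :=
  if x == 0 then 0 else p%:R ^ (- padic_val p x).

Section PadicAbs.
Context (p : nat).
Implicit Types (x y : rat) (m n : int).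

Let logn_nonprime (k : nat) : ~~ prime p -> logn p k = 0%N.
Proof. by move=> /negPf np; rewrite lognE np. Qed.

Lemma padic_val_frac m n : m != 0 -> n != 0 ->
  padic_val p (m%:~R / n%:~R) = (logn p `|m|%N)%:Z - (logn p `|n|%N)%:Z.
Proof.
move=> m0 n0; rewrite /padic_val.
set x := m%:~R / n%:~R.
have nr0 : n%:~R != 0 :> rat by rewrite intr_eq0.
have x0 : x != 0 by rewrite mulf_neq0 ?invr_eq0 // intr_eq0.
have e : numq x * n = m * denq x.
  apply/eqP; rewrite -(eqr_int rat) !rmorphM /= -eqr_div ?intr_eq0 ?denq_eq0 //.
  by rewrite divq_num_den.
have := congr1 absz e; rewrite !abszM => /(congr1 (logn p)).
rewrite !lognM ?absz_gt0 ?numq_eq0 ?denq_eq0 //.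
lia.
Qed.

Lemma padic_abs0 : padic_abs p 0 = 0.
Proof. by rewrite /padic_abs eqxx. Qed.

Lemma padic_abs1 : padic_abs p 1 = 1.
Proof. by rewrite /padic_abs /padic_val !logn1. Qed.

Lemma padic_base_gt0 x : 0 < p%:R ^ padic_val p x :> rat.
Proof.
case: (boolP (prime p)) => [pp|np]; first by rewrite exprz_gt0 // ltr0n prime_gt0.
by rewrite /padic_val !logn_nonprime.
Qed.

Lemma padic_abs_eq0 x : (padic_abs p x == 0) = (x == 0).
Proof.
rewrite /padic_abs; case: ifP; rewrite ?eqxx // => _.
by rewrite -invr_expz invr_eq0 gt_eqF // padic_base_gt0.
Qed.

Lemma padic_abs_ge0 x : 0 <= padic_abs p x.
Proof.
by rewrite /padic_abs; case: ifP => // _; rewrite -invr_expz invr_ge0 ltW // padic_base_gt0.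
Qed.

Lemma padic_valM x y : x != 0 -> y != 0 ->
  padic_val p (x * y) = padic_val p x + padic_val p y.
Proof.
move=> x0 y0.
rewrite -{1}(divq_num_den x) -{1}(divq_num_den y) mulf_div -!rmorphM.
rewrite padic_val_frac ?mulf_neq0 ?numq_eq0 ?denq_eq0 //.
rewrite !abszM !lognM ?absz_gt0 ?numq_eq0 ?denq_eq0 // /padic_val.
by rewrite !PoszD; ring.
Qed.

Lemma padic_absM x y : padic_abs p (x * y) = padic_abs p x * padic_abs p y.
Proof.
rewrite /padic_abs mulf_eq0.
have [->|x0] := eqVneq x 0; first by rewrite /= mul0r.
have [->|y0] := eqVneq y 0; first by rewrite orbT mulr0.
rewrite /= padic_valM // opprD.
case: (boolP (prime p)) => [pp|np].
  by rewrite expfzDr // pnatr_eq0 -lt0n prime_gt0.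
by rewrite /padic_val !logn_nonprime // mulr1.
Qed.

Lemma padic_absN x : padic_abs p (- x) = padic_abs p x.
Proof. by rewrite /padic_abs oppr_eq0 /padic_val numqN denqN abszN. Qed.

Lemma padic_absD x y :
  padic_abs p (x + y) <= Num.max (padic_abs p x) (padic_abs p y).
Proof.
have [->|x0] := eqVneq x 0; first by rewrite add0r le_max lexx orbT.
have [->|y0] := eqVneq y 0; first by rewrite addr0 le_max lexx.
have [->|xy0] := eqVneq (x + y) 0.
  by rewrite padic_abs0 le_max padic_abs_ge0.
rewrite /padic_abs (negPf x0) (negPf y0) (negPf xy0).
case: (boolP (prime p)) => [pp|np]; last first.
  by rewrite /padic_val !logn_nonprime // le_max lexx.
pose a : int := numq x * denq y; pose b : int := numq y * denq x; pose d : int := denq x * denq y.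
have d0 : d != 0 by rewrite mulf_neq0 ?denq_eq0.
have a0 : a != 0 by rewrite mulf_neq0 ?denq_eq0 ?numq_eq0.
have b0 : b != 0 by rewrite mulf_neq0 ?denq_eq0 ?numq_eq0.
have dx : (denq x)%:~R != 0 :> rat by rewrite intr_eq0 denq_eq0.
have dy : (denq y)%:~R != 0 :> rat by rewrite intr_eq0 denq_eq0.
have xE : x = a%:~R / d%:~R.
  by rewrite /a /d !rmorphM /= -mulf_div divq_num_den divff // mulr1.
have yE : y = b%:~R / d%:~R.
  by rewrite /b /d !rmorphM /= [X in _ / X]mulrC -mulf_div divq_num_den divff // mulr1.
have sE : x + y = (a + b)%:~R / d%:~R by rewrite rmorphD /= mulrDl -xE -yE.
have ab0 : a + b != 0.
  by apply: contraNneq xy0 => ab; rewrite sE ab mul0r.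
have key : (minn (logn p (absz a)) (logn p (absz b)) <= logn p (absz (a + b)%R))%N.
  set k := minn _ _.
  rewrite -pfactor_dvdn ?absz_gt0 //.
  suff : ((p ^ k)%:Z %| a + b)%Z by rewrite dvdzE.
  by rewrite rpredD // dvdzE /= pfactor_dvdn ?absz_gt0 // /k ?geq_minl ?geq_minr.
rewrite xE yE -mulrDl -rmorphD /= !padic_val_frac // le_max.
have p1 : 1 < p%:R :> rat by rewrite ltr1n prime_gt1.
rewrite !ler_eXz2l //.
move: (logn p (absz a)) (logn p (absz b)) (logn p (absz (a + b)%R)) (logn p (absz d)) key.
move=> i j k l; rewrite !lerN2 !lerD2r !lez_nat geq_min; exact.
Qed.

Lemma padic_absB x y :
  padic_abs p (x - y) <= Num.max (padic_abs p x) (padic_abs p y).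
Proof. by rewrite -(padic_absN y) padic_absD. Qed.
End PadicAbs.

Definition padic_cauchy (p : nat) : {pred nat -> rat} :=
  [pred u | `[< forall e : rat, 0 < e -> exists N, forall m n : nat,
     (N <= m)%N -> (N <= n)%N -> padic_abs p (u m - u n) < e >]].

Lemma padic_cauchy_bounded p u : u \in padic_cauchy p ->
  exists2 M : rat, 0 < M & forall n, padic_abs p (u n) < M.
Proof.
move=> /asboolP/(_ 1 ltr01)[N uN].
pose M := \sum_(i < N.+1) padic_abs p (u i) + 1.
have le i : (i <= N)%N -> padic_abs p (u i) < M.
  move=> iN; rewrite /M (bigD1 (inord i)) //= inordK // -addrA ltrDl.
  by rewrite ltr_wpDl // sumr_ge0 // => j _; apply: padic_abs_ge0.
have M0 : 1 <= M by rewrite lerDr sumr_ge0 // => j _; apply: padic_abs_ge0.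
exists M => [|n]; first exact: lt_le_trans M0.
case: (leqP n N) => [/le//|/ltnW nN].
rewrite -(subrK (u N) (u n)); apply: le_lt_trans (padic_absD _ _ _) _.
rewrite gt_max le // andbT; apply: lt_le_trans M0; exact: uN.
Qed.

Lemma padic_cauchy_subring p : subring_closed (padic_cauchy p).
Proof.
split=> [|u v /asboolP uC /asboolP vC|u v uC vC].
- apply/asboolP => e e0; exists 0%N => m n _ _.
  by rewrite subrr padic_abs0.
- apply/asboolP => e e0; have [N uN] := uC _ e0; have [N' vN] := vC _ e0.
  exists (maxn N N') => m n; rewrite !geq_max => /andP[m1 m2] /andP[n1 n2].
  have -> : (u - v) m - (u - v) n = (u m - u n) - (v m - v n).
    by rewrite !fctE; ring.
  apply: le_lt_trans (padic_absB _ _ _) _; by rewrite gt_max uN // vN.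
- have [M M0 uM] := padic_cauchy_bounded uC.
  have [M' M'0 vM] := padic_cauchy_bounded vC.
  move: uC vC => /asboolP uC /asboolP vC.
  apply/asboolP => e e0.
  have [N uN] := uC _ (divr_gt0 e0 M'0); have [N' vN] := vC _ (divr_gt0 e0 M0).
  exists (maxn N N') => m n; rewrite !geq_max => /andP[m1 m2] /andP[n1 n2].
  have -> : (u * v) m - (u * v) n = (u m - u n) * v m + u n * (v m - v n).
    by rewrite !fctE; ring.
  apply: le_lt_trans (padic_absD _ _ _) _; rewrite !padic_absM gt_max.
  have lem a b c : 0 <= a -> 0 <= b -> b < c -> 0 < c -> a < e / c -> a * b < e.
    move=> a0 b0 bc c0; rewrite ltr_pdivlMr //; apply: le_lt_trans.
    by rewrite ler_wpM2l // ltW.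
  rewrite (lem _ _ M') ?padic_abs_ge0 ?vM ?uN //= mulrC.
  by rewrite (lem _ _ M) ?padic_abs_ge0 ?uM ?vN.
Qed.

HB.instance Definition _ p :=
  GRing.isSubringClosed.Build (nat -> rat) (padic_cauchy p) (padic_cauchy_subring p).

Definition padic_seq (p : nat) := {u : nat -> rat | u \in padic_cauchy p}.
HB.instance Definition _ p := SubChoice.on (padic_seq p).
HB.instance Definition _ p := [SubChoice_isSubComNzRing of padic_seq p by <:].

Definition padic_null (p : nat) : {pred padic_seq p} :=
  [pred u | `[< forall e : rat, 0 < e -> exists N, forall n : nat,
     (N <= n)%N -> padic_abs p (val u n) < e >]].

Lemma padic_null_idealr p : idealr_closed (@padic_null p).
Proof.
split=> [|/=|a u v /asboolP uN /asboolP vN].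
- by apply/asboolP => e e0; exists 0%N => n _; rewrite padic_abs0.
- apply/asboolP => /(_ 1 ltr01)[N /(_ N (leqnn N))].
  by rewrite padic_abs1 ltxx.
- have [M M0 aM] := padic_cauchy_bounded (valP a).
  apply/asboolP => e e0; have [N uNe] := uN _ (divr_gt0 e0 M0).
  have [N' vNe] := vN _ e0; exists (maxn N N') => n; rewrite geq_max => /andP[n1 n2].
  rewrite /= !fctE; apply: le_lt_trans (padic_absD _ _ _) _.
  rewrite gt_max vNe // andbT padic_absM mulrC.
  have := uNe _ n1; rewrite ltr_pdivlMr //; apply: le_lt_trans.
  by rewrite ler_wpM2l ?padic_abs_ge0 // ltW // aM.
Qed.

HB.instance Definition _ p :=
  isIdealr.Build (padic_seq p) (@padic_null p) (@padic_null_idealr p).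

(* Q_p is the completion of rat for |.|_p: Cauchy sequences modulo null
   sequences.  Qp_dense and Qp_complete below check that this is a completion;
   rationals embed through the generic ratr (see ratr_Qp, Qp_abs_ratr). *)
Definition Qp (p : nat) := {ideal_quot (@padic_null p)}.

HB.instance Definition _ p := GRing.ComNzRing.on (Qp p).

Definition Qp_class (p : nat) (u : padic_seq p) : Qp p := \pi_(Qp p)%qT u.

Lemma Qp_class_repr p (x : Qp p) : Qp_class (repr x) = x.
Proof. exact: reprK. Qed.

Lemma Qp_class_is_zmod_morphism p : zmod_morphism (@Qp_class p).
Proof. by move=> u v; rewrite /Qp_class rmorphB. Qed.

Lemma Qp_class_is_monoid_morphism p : monoid_morphism (@Qp_class p).
Proof. by split=> [|u v]; rewrite /Qp_class ?rmorph1 ?rmorphM. Qed.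

HB.instance Definition _ p :=
  GRing.isZmodMorphism.Build (padic_seq p) (Qp p) (@Qp_class p)
    (@Qp_class_is_zmod_morphism p).
HB.instance Definition _ p :=
  GRing.isMonoidMorphism.Build (padic_seq p) (Qp p) (@Qp_class p)
    (@Qp_class_is_monoid_morphism p).

Lemma Qp_class_eq p (u v : padic_seq p) :
  (Qp_class u == Qp_class v) = (u - v \in @padic_null p).
Proof. by rewrite Quotient.idealrBE. Qed.

Lemma padic_abs_eqr p (x y : rat) :
  padic_abs p (x - y) < padic_abs p y -> padic_abs p x = padic_abs p y.
Proof.
move=> h; apply/le_anti/andP; split.
  rewrite -(subrK y x); apply: le_trans (padic_absD _ _ _) _.
  by rewrite ge_max lexx ltW.
rewrite leNgt; apply/negP => lt.
have : padic_abs p y <= Num.max (padic_abs p x) (padic_abs p (x - y)).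
  have {1}-> : y = x - (x - y) by ring.
  exact: padic_absB.
by rewrite le_max !leNgt lt h.
Qed.

Lemma padic_cauchy_abs p (u : padic_seq p) : u \notin @padic_null p ->
  exists2 c : rat, 0 < c &
    exists N, forall n, (N <= n)%N -> padic_abs p (val u n) = c.
Proof.
move=> /asboolPn/existsNP[e /not_implyP[e0 uN]].
have /asboolP/(_ e e0)[N uC] := valP u.
move/forallNP/(_ N)/existsNP : uN => [k /not_implyP[Nk /negP]].
rewrite -leNgt => uk; exists (padic_abs p (val u k)); first exact: lt_le_trans uk.
by exists N => n Nn; apply: padic_abs_eqr; apply: lt_le_trans (uC _ _ Nn Nk) uk.
Qed.

Definition Qp_inv (p : nat) (x : Qp p) : Qp p := xget 0 [set y | y * x = 1].

Lemma Qp_mulVf p (x : Qp p) : x != 0 -> Qp_inv x * x = 1.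
Proof.
move=> x0; rewrite /Qp_inv; apply: (@xgetPex _ 0 [set y | y * x = 1]).
set u := repr x.
have : u \notin @padic_null p.
  by apply: contra x0 => u0; rewrite -(Qp_class_repr x) -(rmorph0 (@Qp_class p)) Qp_class_eq subr0.
move=> /padic_cauchy_abs[c c0 [N uN]].
have uN0 n : (N <= n)%N -> val u n != 0.
  by move=> /uN un; rewrite -(padic_abs_eq0 p) un gt_eqF.
have vC : (fun n => (val u n)^-1) \in padic_cauchy p.
  apply/asboolP => e e0; have /asboolP/(_ (e * (c * c)))[] := valP u.
    by rewrite !mulr_gt0.
  move=> N' uC; exists (maxn N N') => m n; rewrite !geq_max => /andP[m1 m2] /andP[n1 n2].
  have um := uN0 _ m1; have un := uN0 _ n1.
  rewrite -(ltr_pM2r (mulr_gt0 c0 c0)) -{1}(uN _ m1) -{1}(uN _ n1) -!padic_absM.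
  suff -> : ((val u m)^-1 - (val u n)^-1) * (val u m * val u n) = val u n - val u m.
    exact: uC.
  by rewrite mulrBl mulKf // [X in _ - _ * X]mulrC mulKf.
exists (Qp_class (exist (fun v => v \in padic_cauchy p) _ vC)) => /=.
rewrite -[X in _ * X]Qp_class_repr -rmorphM; apply/eqP.
rewrite -(rmorph1 (@Qp_class p)) Qp_class_eq.
apply/asboolP => e e0; exists N => n Nn /=.
by rewrite !fctE /= mulVf ?uN0 // subrr padic_abs0.
Qed.

Lemma Qp_invr0 p : Qp_inv (0 : Qp p) = 0.
Proof.
apply: xgetPN => y /=; rewrite mulr0 => /esym/eqP.
by rewrite oner_eq0.
Qed.

HB.instance Definition _ p :=
  GRing.ComNzRing_isField.Build (Qp p) (@Qp_mulVf p) (@Qp_invr0 p).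

(* |x|_p is the limit of |u_n|_p for any Cauchy sequence u representing x; the
   limit exists in rat because |u_n|_p is eventually constant or tends to 0. *)
Definition Qp_abs (p : nat) (x : Qp p) : rat :=
  limn (fun n => padic_abs p (val (repr x) n) : rat^o).

Lemma Qp_abs_null p (u : padic_seq p) : u \in @padic_null p ->
  Qp_abs (Qp_class u) = 0.
Proof.
move=> u0; rewrite /Qp_abs; set v := repr _.
have /asboolP vN : v \in @padic_null p.
  rewrite -(subrK u v) rpredD // -Qp_class_eq; apply/eqP; exact: Qp_class_repr.
apply: (@cvg_lim rat^o) => //; apply/(@cvgrPdist_lt _ rat^o) => e /vN[N vNe].
exists N => // n /= Nn.
by rewrite sub0r normrN ger0_norm ?padic_abs_ge0 ?vNe.
Qed.

Lemma Qp_abs_near p (u : padic_seq p) (c : rat) : 0 < c ->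
  (exists N, forall n, (N <= n)%N -> padic_abs p (val u n) = c) ->
  Qp_abs (Qp_class u) = c.
Proof.
move=> c0 [N uc]; rewrite /Qp_abs; set v := repr _.
have : v - u \in @padic_null p.
  rewrite -Qp_class_eq; apply/eqP; exact: Qp_class_repr.
move=> /asboolP/(_ _ c0)[N' vu].
apply: (@cvg_lim rat^o) => //; apply: (@cvg_near_cst _ rat^o).
exists (maxn N N') => // n /=; rewrite geq_max => /andP[n1 n2].
rewrite -(uc _ n1); apply: padic_abs_eqr; rewrite (uc _ n1); exact: vu.
Qed.

Lemma Qp_abs_ltP p (u : padic_seq p) (e : rat) : 0 < e ->
  Qp_abs (Qp_class u) < e <->
  exists N, forall n, (N <= n)%N -> padic_abs p (val u n) < e.
Proof.
move=> e0; case: (boolP (u \in @padic_null p)) => [u0|].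
  by rewrite Qp_abs_null //; split=> // _; move/asboolP : u0; exact.
move=> /padic_cauchy_abs[c c0 uc]; rewrite (Qp_abs_near c0 uc).
case: uc => N uc; split=> [ce|[N' uN']].
  by exists N => n /uc ->.
by rewrite -(uc (maxn N N')) ?leq_maxl // uN' // leq_maxr.
Qed.

Lemma Qp_abs_ge0 p (x : Qp p) : 0 <= Qp_abs x.
Proof.
rewrite -(Qp_class_repr x).
case: (boolP (repr x \in @padic_null p)) => [u0|]; first by rewrite Qp_abs_null.
by move=> /padic_cauchy_abs[c c0 uc]; rewrite (Qp_abs_near c0 uc) ltW.
Qed.

Lemma Qp_abs0 p : Qp_abs (0 : Qp p) = 0.
Proof. by rewrite -(rmorph0 (@Qp_class p)) Qp_abs_null // rpred0. Qed.

Lemma Qp_abs_eq0 p (x : Qp p) : (Qp_abs x == 0) = (x == 0).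
Proof.
apply/idP/idP => [|/eqP ->]; last by rewrite Qp_abs0.
rewrite -(Qp_class_repr x); case: (boolP (repr x \in @padic_null p)) => [u0 _|].
  by rewrite -(rmorph0 (@Qp_class p)) Qp_class_eq subr0.
by move=> /padic_cauchy_abs[c c0 uc]; rewrite (Qp_abs_near c0 uc) gt_eqF.
Qed.

Lemma Qp_absM p (x y : Qp p) : Qp_abs (x * y) = Qp_abs x * Qp_abs y.
Proof.
have [->|x0] := eqVneq x 0; first by rewrite mul0r Qp_abs0 mul0r.
have [->|y0] := eqVneq y 0; first by rewrite mulr0 Qp_abs0 mulr0.
move: x0 y0; rewrite -(Qp_class_repr x) -(Qp_class_repr y).
rewrite -rmorphM -(rmorph0 (@Qp_class p)) !Qp_class_eq !subr0.
move=> /padic_cauchy_abs[c c0 xc] /padic_cauchy_abs[d d0 yd].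
rewrite (Qp_abs_near c0 xc) (Qp_abs_near d0 yd); apply: Qp_abs_near.
  exact: mulr_gt0.
case: xc yd => N xc [N' yd]; exists (maxn N N') => n.
by rewrite geq_max => /andP[/xc {1}<- /yd <-]; rewrite -padic_absM.
Qed.

Lemma padic_cst_cauchy p (q : rat) : (fun=> q) \in padic_cauchy p.
Proof.
by apply/asboolP => e e0; exists 0%N => m n _ _; rewrite subrr padic_abs0.
Qed.

Definition padic_cst (p : nat) (q : rat) : padic_seq p :=
  exist (fun v => v \in padic_cauchy p) _ (padic_cst_cauchy p q).

Lemma padic_cst_is_zmod_morphism p : zmod_morphism (padic_cst p).
Proof. by move=> u v; apply: val_inj. Qed.

Lemma padic_cst_is_monoid_morphism p : monoid_morphism (padic_cst p).
Proof. by split=> [|u v]; apply: val_inj. Qed.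

HB.instance Definition _ p :=
  GRing.isZmodMorphism.Build rat (padic_seq p) (padic_cst p)
    (padic_cst_is_zmod_morphism p).
HB.instance Definition _ p :=
  GRing.isMonoidMorphism.Build rat (padic_seq p) (padic_cst p)
    (padic_cst_is_monoid_morphism p).

Lemma ratr_Qp p (q : rat) : ratr q = Qp_class (padic_cst p q).
Proof. exact/esym/(fmorph_eq_rat (@Qp_class p \o padic_cst p)). Qed.

Lemma ratr_Qp_is_zmod_morphism p : zmod_morphism (ratr : rat -> Qp p).
Proof. by move=> q r; rewrite !ratr_Qp !rmorphB. Qed.

Lemma ratr_Qp_is_monoid_morphism p : monoid_morphism (ratr : rat -> Qp p).
Proof. by split=> [|q r]; rewrite !ratr_Qp ?rmorph1 ?rmorphM ?rmorph1. Qed.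

Lemma Qp_abs_ratr p (q : rat) : Qp_abs (ratr q : Qp p) = padic_abs p q.
Proof.
rewrite ratr_Qp; have [->|q0] := eqVneq q 0.
  by rewrite rmorph0 (rmorph0 (@Qp_class p)) Qp_abs0 padic_abs0.
apply: Qp_abs_near; last by exists 0%N.
by rewrite lt_neqAle padic_abs_ge0 eq_sym padic_abs_eq0 q0.
Qed.

Lemma Qp_absN p (x : Qp p) : Qp_abs (- x) = Qp_abs x.
Proof.
have -> : - x = ratr (- 1) * x by rewrite ratr_Qp !rmorphN !rmorph1 mulN1r.
by rewrite Qp_absM Qp_abs_ratr padic_absN padic_abs1 mul1r.
Qed.

Lemma Qp_absD p (x y : Qp p) :
  Qp_abs (x + y) <= Num.max (Qp_abs x) (Qp_abs y).
Proof.
rewrite leNgt; apply/negP; rewrite gt_max => /andP[].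
have [/eqP|xy0] := eqVneq (Qp_abs (x + y)) 0.
  by rewrite Qp_abs_eq0 => /eqP ->; rewrite Qp_abs0 ltNge Qp_abs_ge0.
set e := Qp_abs (x + y).
have e0 : 0 < e by rewrite lt_neqAle eq_sym xy0 Qp_abs_ge0.
rewrite -(Qp_class_repr x) -(Qp_class_repr y).
move=> /(Qp_abs_ltP _ e0)[N xN] /(Qp_abs_ltP _ e0)[N' yN].
suff : e < e by rewrite ltxx.
rewrite {1}/e -(Qp_class_repr x) -(Qp_class_repr y) -rmorphD.
apply/(Qp_abs_ltP _ e0); exists (maxn N N') => n.
rewrite geq_max => /andP[n1 n2]; apply: le_lt_trans (padic_absD _ _ _) _.
by rewrite gt_max xN // yN.
Qed.

Definition Qp_dist (p : nat) (x y : Qp p) : rat := Qp_abs (x - y).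

Lemma Qp_distxx p (x : Qp p) : Qp_dist x x = 0.
Proof. by rewrite /Qp_dist subrr Qp_abs0. Qed.

Lemma Qp_dist_eq0 p (x y : Qp p) : Qp_dist x y = 0 -> x = y.
Proof. by move/eqP; rewrite Qp_abs_eq0 subr_eq0 => /eqP. Qed.

Lemma Qp_distC p (x y : Qp p) : Qp_dist x y = Qp_dist y x.
Proof. by rewrite /Qp_dist -Qp_absN opprB. Qed.

Lemma Qp_dist_max p (y x z : Qp p) :
  Qp_dist x z <= Num.max (Qp_dist x y) (Qp_dist y z).
Proof. by rewrite /Qp_dist -(subrK y x) -addrA subrK Qp_absD. Qed.

Lemma Qp_dist_triangle p (y x z : Qp p) :
  Qp_dist x z <= Qp_dist x y + Qp_dist y z.
Proof.
apply: le_trans (Qp_dist_max y x z) _.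
by rewrite ge_max lerDl lerDr !Qp_abs_ge0.
Qed.

HB.instance Definition _ p := isMetric.Build rat (Qp p)
  (@Qp_distxx p) (@Qp_dist_eq0 p) (@Qp_distC p) (@Qp_dist_triangle p).
HB.instance Definition _ p := isPointed.Build (Qp p) 0.

Lemma Qp_ballE p (x : Qp p) (e : rat) : ball x e = [set y | Qp_abs (x - y) < e].
Proof. exact: ballEmdist. Qed.

Lemma Qp_dense p (x : Qp p) (e : rat) : 0 < e ->
  exists q : rat, Qp_abs (x - ratr q) < e.
Proof.
move=> e0; have /asboolP/(_ e e0)[N xN] := valP (repr x).
exists (val (repr x) N); rewrite -{1}(Qp_class_repr x) ratr_Qp -rmorphB.
by apply/(Qp_abs_ltP _ e0); exists N => n Nn; exact: xN.
Qed.

Lemma Qp_complete p (F : set_system (Qp p)) : ProperFilter F -> cauchy F -> cvg F.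
Proof.
move=> FF /cauchyP Fc.
have h n : exists q : rat, F (ball (ratr q : Qp p) n.+1%:R^-1).
  have n0 : 0 < n.+1%:R^-1 :> rat by rewrite invr_gt0.
  have [x Fx] := Fc _ n0; have [q xq] := Qp_dense x n0; exists q.
  apply: filterS Fx => y; rewrite !Qp_ballE /= => xy.
  apply: le_lt_trans (Qp_dist_max x _ _) _.
  by rewrite gt_max {1}Qp_distC xq.
have [q qF] := choice h.
have qd m n : padic_abs p (q m - q n) < Num.max m.+1%:R^-1 n.+1%:R^-1.
  have [y [ym yn]] := filter_ex (filterI (qF m) (qF n)).
  move: ym yn; rewrite !Qp_ballE /= => ym yn.
  rewrite -Qp_abs_ratr ratr_Qp_is_zmod_morphism; apply: le_lt_trans (Qp_dist_max y _ _) _.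
  rewrite gt_max !lt_max ym /=; apply/orP; right.
  by rewrite Qp_distC.
have small (e : rat) : 0 < e -> exists N, forall n, (N <= n)%N -> n.+1%:R^-1 < e.
  move=> e0; exists (Num.truncn e^-1) => n Nn.
  rewrite invf_plt ?posrE //; apply: lt_le_trans (_ : (Num.truncn e^-1).+1%:R <= _).
    by rewrite truncnS_gt.
  by rewrite ler_nat.
have qC : q \in padic_cauchy p.
  apply/asboolP => e /small[N Ne]; exists N => m n Nm Nn.
  by apply: lt_le_trans (qd m n) _; rewrite ge_max !ltW // Ne.
apply/cvg_ex; exists (Qp_class (exist (fun v => v \in padic_cauchy p) _ qC)).
apply/fcvg_ballP => e e0.
have [N Ne] := small _ e0; apply: filterS (qF N) => y; rewrite !Qp_ballE /= => yN.
apply: le_lt_trans (Qp_dist_max (ratr (q N)) _ _) _.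
rewrite gt_max (lt_trans yN) ?Ne // andbT /Qp_dist ratr_Qp -rmorphB.
apply/(Qp_abs_ltP _ e0); exists N => n Nn /=.
apply: lt_le_trans (qd n N) _; by rewrite ge_max !ltW // Ne.
Qed.

HB.instance Definition _ p := Uniform_isComplete.Build (Qp p) (@Qp_complete p).

(* A sequence f : nat -> rat stands for the formal power series
   \sum_n (f n) t^n. *)
Definition fps_mul (f g : nat -> rat) (n : nat) : rat :=
  \sum_(k < n.+1) f (n - k)%N * g k.

Fixpoint fps_inv_seq (f : nat -> rat) (n : nat) : seq rat :=
  if n is m.+1 then
    let s := fps_inv_seq f m in
    rcons s (((m == 0%N)%:R - \sum_(k < m) f (m - k)%N * s`_k) / f 0%N)
  else [::].

Definition fps_inv (f : nat -> rat) (n : nat) : rat := (fps_inv_seq f n.+1)`_n.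

Lemma size_fps_inv_seq f n : size (fps_inv_seq f n) = n.
Proof. by elim: n => //= n IHn; rewrite size_rcons IHn. Qed.

Lemma nth_fps_inv_seq f n k : (k < n)%N -> (fps_inv_seq f n)`_k = fps_inv f k.
Proof.
elim: n => // n IHn; rewrite ltnS leq_eqVlt => /predU1P[->//|kn].
by rewrite /= nth_rcons size_fps_inv_seq kn IHn.
Qed.

Lemma fps_mulV f n : f 0%N != 0 -> fps_mul f (fps_inv f) n = (n == 0%N)%:R.
Proof.
move=> f0; rewrite /fps_mul big_ord_recr /= subnn.
rewrite [fps_inv f n]/fps_inv /= nth_rcons size_fps_inv_seq ltnn eqxx.
rewrite mulrC divfK // addrC.
under eq_bigr => k _ do rewrite nth_fps_inv_seq //.
by rewrite subrK.
Qed.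

(* t / (e^t - 1) is the inverse of (e^t - 1) / t = \sum_k t^k / (k + 1)!.
   bernoulli_egf restates this as (e^t - 1) * \sum_k B_k t^k / k! = t. *)
Definition bernoulli (n : nat) : rat :=
  n`!%:R * fps_inv (fun k => (k.+1)`!%:R^-1) n.

Lemma bernoulli_egf n :
  fps_mul (fun k => k`!%:R^-1 - (k == 0%N)%:R) (fun k => bernoulli k / k`!%:R) n
  = (n == 1%N)%:R.
Proof.
have fact_neq0 k : k`!%:R != 0 :> rat by rewrite pnatr_eq0 -lt0n fact_gt0.
rewrite /fps_mul big_ord_recr /= subnn fact0 invr1 subrr mul0r addr0.
case: n => [|n]; first by rewrite big_ord0.
rewrite eqSS -(@fps_mulV (fun k => (k.+1)`!%:R^-1)) ?invr_eq0 //.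
apply: eq_bigr => k _; rewrite /bernoulli mulrAC divff // mul1r.
by rewrite subSn -1?ltnS // subr0.
Qed.

Definition theta_coef (n : nat) : rat := (2 ^+ n.+1 - 2) * bernoulli n.

(* limn is taken in the p-adic metric of Qp p.  Its value on a divergent series
   would be the default point 0, a rational, so that irrationality of Theta
   entails convergence of the series. *)
Definition Theta (p : nat) (a : int) (F : nat) : Qp p :=
  limn (series (fun n =>
    ratr (theta_coef n) * (- (F%:R / a%:~R)) ^+ n.+1 : Qp p)).

(* Main.v *)
Require Import Defs.
From HB Require Import structures.
From mathcomp Require Import all_boot all_order all_algebra.
From mathcomp Require Import all_classical all_reals all_analysis.
From mathcomp Require Import ring lra zify.
Set Implicit Arguments.
Unset Strict Implicit.
Unset Printing Implicit Defensive.
Import Order.TTheory GRing.Theory Num.Theory.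
Local Open Scope ring_scope.

(** Write x = a/F, so that |x|_p = p^r > 1, and let G be the linear functional
    on polynomials with G(y^n) = t_n.  Expanding in powers of 1/x, Theta is
    formally - G(1/(x+y)).  The functional equation
    G(f(y+1) + f(y)) = - 2 f'(0), a form of the generating series of the
    Bernoulli numbers, determines G on the polynomials
    N_j(y) = (y-j+1) ... y (y+1) ... (y+j) and y N_j(y).  Newton expansion of
    1/(x+y) at the nodes 0, -1, 1, -2, 2, ... turns the Bernoulli series into the
    inverse factorial series
      Theta = sum_j (-1)^(j+1) j!^2 / N_(j+1)(-x),
    first formally and then p-adically ([theta_inverse_factorial_close]), because G
    takes integral values on integral polynomials ([umbral_theta_int]).

    Assume that Theta equals a rational number xi.  Let e_k be the k-th partial
    sum of the inverse factorial series, and put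
      R_n = sum_k C(n,k) N_k(-x)/k!^2 (xi - e_k).
    These are the remainders Q_n xi - P_n of diagonal Pade approximants whose
    denominators Q_n = sum_k C(n,k) C(x-1,k) C(x-1+k,k) are a specialisation
    of continuous dual Hahn polynomials.  As rational numbers the R_n have the
    following properties.

    - They satisfy, with lam = x^2 - x,
        (n+1)^2 (R_(n+1) - R_n) = n^2 (R_n - R_(n-1)) + lam R_n   (n >= 1)
      ([remainder_recurrence]).  Hence no two consecutive ones vanish, and
      their ordinary absolute values grow at most polynomially
      ([theta_recurrence_growth]).
    - The R_n are p-adically bounded, while |lam|_p = p^(2r) > 1, so that every
      solution that does not decrease explodes.  Therefore
      |R_n|_p <= |n!|_p^2 p^(-2rn) |xi|_p ([theta_recurrence_minimal]).
    - Let d_n = lcm(1..n), let (n!)_F be the part of n! made of the primes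
      dividing F, and let mu_n = F^n (n!)_F.  Up to the denominator of xi,
      d_n^2 mu_n^2 clears the denominator of R_n ([remainder_int]).

    A nonzero integer z satisfies 1 <= |z|_p |z|.  For z = d_n^2 mu_n^2 R_n,
    with |mu_n|_p = p^(-rn) |n!|_p, this bounds p^(4 (r n + v_p(n!))) by
    d_n^2 mu_n^2 times a polynomial in n ([remainder_padic_real]).  On dividing
    the logarithms by 2n and using v_q(n!) ~ n/(q-1), the limit is
      2 r log p + 2 log p/(p-1) <= log F + sum_(q | F) log q/(q-1) + c
    as soon as log d_n <= (c + o(1)) n along some sequence of n.  The value
    c = 1 would follow from the prime number theorem, but infinitely many n are
    enough, and for these Chebyshev's identity prod_k d_(n/k) = n! suffices
    ([lcm_upto_small_often]). *)

(** * The functional defined by the coefficients of Theta *)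

(** In umbral notation this is f(u), where each power u^n is read as u_n. *)
Definition umbral (u : nat -> rat) (f : {poly rat}) : rat :=
  \sum_(i < size f) f`_i * u i.

Lemma umbral_wide u (f : {poly rat}) n : (size f <= n)%N ->
  umbral u f = \sum_(i < n) f`_i * u i.
Proof.
move=> fn; rewrite /umbral (big_ord_widen n (fun i => f`_i * u i)) //.
rewrite big_mkcond /=; apply: eq_bigr => i _.
by case: ltnP => // /leq_sizeP/(_ i (leqnn _)) ->; rewrite mul0r.
Qed.

Lemma umbral_is_linear u : scalar (umbral u).
Proof.
move=> a f g; pose n := maxn (size (a *: f + g)) (maxn (size f) (size g)).
rewrite !(@umbral_wide u _ n) ?leq_max ?leqnn ?orbT //.
rewrite mulr_sumr -big_split /=; apply: eq_bigr => i _.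
by rewrite coefD coefZ mulrDl -mulrA.
Qed.

HB.instance Definition _ u :=
  GRing.isLinear.Build rat {poly rat} rat *%R (umbral u) (umbral_is_linear u).

Lemma umbralXn u n : umbral u 'X^n = u n.
Proof.
rewrite /umbral size_polyXn big_ord_recr /= coefXn eqxx mul1r big1 ?add0r //.
by move=> i _; rewrite coefXn ltn_eqF ?mul0r.
Qed.

Local Notation translate f := (f \Po ('X + 1)).

Lemma fact_rat_neq0 n : n`!%:R != 0 :> rat.
Proof. by rewrite pnatr_eq0 -lt0n fact_gt0. Qed.

Lemma bernoulli_binom_sum n :
  \sum_(k < n) 'C(n, k)%:R * bernoulli k = (n == 1%N)%:R.
Proof.
have := bernoulli_egf n; rewrite /fps_mul big_ord_recr /= subnn fact0 invr1.
rewrite subrr mul0r addr0 => /(congr1 (fun x => n`!%:R * x)).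
have -> : n`!%:R * (n == 1%N)%:R = (n == 1%N)%:R :> rat.
  by case: eqP => [->|_]; rewrite ?mulr0 // mulr1.
move=> <-; rewrite mulr_sumr; apply: eq_bigr => k _.
have -> : (n - k == 0)%N = false by apply/negbTE; rewrite -lt0n subn_gt0.
rewrite subr0 -(bin_fact (ltnW (ltn_ord k))) !natrM.
by field; rewrite !fact_rat_neq0.
Qed.

(** The identity (e^t - 1) (t/(e^t - 1)) = t, read as a statement about the
    functional y^n |-> B_n. *)
Lemma umbral_bernoulli_diff f : umbral bernoulli (translate f - f) = f`_1.
Proof.
rewrite -[f]coefK poly_def (raddf_sum (comp_poly _)) -sumrB linear_sum coef_sum.
apply: eq_bigr => n _; rewrite /= comp_polyZ -scalerBr linearZ coefZ /= coefXn.
congr (_ * _); rewrite comp_Xn_poly ['X + 1]addrC exprDn big_ord_recr /= subnn expr0.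
rewrite mul1r binn mulr1n addrK eq_sym -bernoulli_binom_sum linear_sum.
apply: eq_bigr => k _; rewrite expr1n mul1r linearMn /= umbralXn.
by rewrite mulr_natl.
Qed.

(** With it, an identity for a functional on polynomials need only be checked on
    differences, where [umbral_bernoulli_diff] evaluates the Bernoulli
    functional. *)
Lemma poly_diff_surj (h : {poly rat}) : exists k, translate k - k = h.
Proof.
have [n] := ubnP (size h); elim: n => // n IHn in h * => hn.
case: n => [|n] in IHn hn *.
  by exists 0; rewrite comp_poly0 subrr; apply/esym/eqP; rewrite -size_poly_eq0; case: size hn.
pose c := h`_n / n.+1%:R; pose k1 : {poly rat} := c *: 'X^(n.+1).
have dk1 : translate k1 - k1 = \sum_(i < n.+1) (c * 'C(n.+1, i)%:R) *: 'X^i.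
  rewrite /k1 comp_polyZ -scalerBr comp_Xn_poly ['X + 1]addrC exprDn big_ord_recr /=.
  rewrite subnn expr0 mul1r binn mulr1n addrK scaler_sumr.
  by apply: eq_bigr => i _; rewrite expr1n mul1r -scalerMnr scalerMnl mulr_natr.
have [|k2 k2E] := IHn (h - (translate k1 - k1)).
  rewrite ltnS; apply/leq_sizeP => j; rewrite leq_eqVlt => /predU1P[<-|nj].
    rewrite coefB dk1 coef_sum big_ord_recr /= coefZ coefXn eqxx mulr1.
    rewrite big1 ?add0r => [|i _]; last by rewrite coefZ coefXn gtn_eqF ?mulr0.
    by rewrite binSn /c divfK ?subrr // pnatr_eq0.
  rewrite coefB dk1 coef_sum big1 => [|i _]; last first.
    by rewrite coefZ coefXn gtn_eqF ?mulr0 // (leq_trans (ltn_ord i)).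
  by rewrite subr0 nth_default // -ltnS (leq_trans hn).
by exists (k1 + k2); rewrite comp_polyD opprD addrACA k2E addrC subrK.
Qed.

(** Raabe's multiplication formula for the factor 2.  On h(y) = k(y+1) - k(y) the
    left-hand argument telescopes to the difference of k(2y), and both sides are
    2 k'(0). *)
Lemma umbral_bernoulli_double h :
  umbral bernoulli ((h \Po (2 *: 'X)) + (h \Po (2 *: 'X + 1)))
  = 2 * umbral bernoulli h.
Proof.
have [k <-] := poly_diff_surj h; rewrite umbral_bernoulli_diff.
have c1 : (k \Po (2 *: 'X))`_1 = 2 * k`_1.
  rewrite -[k]coefK poly_def (raddf_sum (comp_poly _)) !coef_sum mulr_sumr.
  apply: eq_bigr => i _; rewrite /= comp_polyZ comp_Xn_poly exprZn !coefZ coefXn.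
  by case: eqP => [<-|_]; rewrite ?mulr0 // expr1; ring.
rewrite -c1 -(umbral_bernoulli_diff (k \Po (2 *: 'X))); congr umbral.
rewrite !comp_polyB -!comp_polyA !comp_polyD !comp_polyZ !comp_polyX !comp_polyC !polyC1.
have -> : 2 *: 'X + 1 + 1 = 2 *: ('X + 1) :> {poly rat}.
  by rewrite scalerDr -addrA !scaler_nat [1 *+ 2]mulr2n.
ring.
Qed.

Lemma umbral_theta f :
  umbral theta_coef f
  = 2 * umbral bernoulli (f \Po (2 *: 'X)) - 2 * umbral bernoulli f.
Proof.
rewrite -[f]coefK poly_def (raddf_sum (comp_poly _)) !linear_sum !mulr_sumr -sumrB.
apply: eq_bigr => i _; rewrite /= comp_polyZ comp_Xn_poly exprZn !linearZ /= !umbralXn.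
by rewrite /theta_coef exprS; ring.
Qed.

(** Writing t_n = 2 (2^n B_n) - 2 B_n, the shifted sum is
    4 beta(f) - 2 beta(f(y+1)) - 2 beta(f) for the Bernoulli functional beta, by
    Raabe's formula, which leaves a single difference of f. *)
Lemma umbral_theta_shift f : umbral theta_coef (translate f + f) = - 2 * f`_1.
Proof.
rewrite -umbral_bernoulli_diff umbral_theta comp_polyD -comp_polyA.
rewrite comp_polyD comp_polyX comp_polyC [X in umbral _ X]addrC.
rewrite umbral_bernoulli_double raddfB raddfD /=; ring.
Qed.

(** * Its values on windows of consecutive factors *)

(** The window (y-j+1) ... (y+j) of 2j consecutive factors, paired so that passing
    from j to j+1 adds one
    factor on each side.  These are the Newton polynomials of even degree
    for the nodes 0, -1, 1, -2, 2, ... *)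
Definition node_poly (j : nat) : {poly rat} :=
  \prod_(i < j) (('X + i.+1%:R) * ('X - i%:R)).

Lemma node_polyS j :
  node_poly j.+1 = node_poly j * (('X + j.+1%:R) * ('X - j%:R)).
Proof. by rewrite /node_poly big_ord_recr. Qed.

(** The odd window (y-j) ... (y+j): its translate by 1 shares with it exactly the
    factors of node_poly j, and therefore the functional equation applied to it
    produces multiples of node_poly j. *)
Definition sym_poly (j : nat) : {poly rat} :=
  'X * \prod_(i < j) (('X + i.+1%:R) * ('X - i.+1%:R)).

Lemma sym_polyS j :
  sym_poly j.+1 = sym_poly j * (('X + j.+1%:R) * ('X - j.+1%:R)).
Proof. by rewrite /sym_poly big_ord_recr /= mulrA. Qed.

Lemma sym_poly_node j : sym_poly j = node_poly j * ('X - j%:R).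
Proof.
elim: j => [|j IHj]; first by rewrite /sym_poly /node_poly !big_ord0; ring.
by rewrite sym_polyS node_polyS IHj; ring.
Qed.

Lemma translate_sym_poly j : translate (sym_poly j) = node_poly j * ('X + j.+1%:R).
Proof.
elim: j => [|j IHj].
  by rewrite /sym_poly /node_poly !big_ord0 mulr1 comp_polyX; ring.
rewrite sym_polyS comp_polyM IHj node_polyS !comp_polyM comp_polyD comp_polyB.
by rewrite comp_polyX -!polyC_natr !comp_polyC !polyC_natr -![in RHS]natr1 -natr1; ring.
Qed.

Lemma sym_poly_coef0 j : (sym_poly j)`_0 = 0.
Proof. by rewrite /sym_poly coefXM. Qed.

Lemma sym_poly_coef1 j : (sym_poly j)`_1 = (-1) ^+ j * j`!%:R ^+ 2.
Proof.
rewrite /sym_poly coefXM /=; elim: j => [|j IHj].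
  by rewrite big_ord0 coef1 fact0 expr0 expr1n mulr1.
rewrite big_ord_recr -horner_coef0 hornerM horner_coef0 IHj /=.
rewrite -!polyC_natr hornerM !(hornerD, hornerN, hornerX, hornerC) factS natrM.
by rewrite [(-1) ^+ j.+1]exprS; ring.
Qed.

(** The functional equation for f = sym_poly j has left side
    node_poly j (2y + 1), and for y f it has left side
    2 node_poly (j+1) + (2j+1)(j+1) node_poly j.  The derivatives at 0 are
    (-1)^j j!^2 and 0.  By induction the second shows that the functional kills
    every node_poly j, and the first then gives its value on y node_poly j. *)
Lemma umbral_theta_node_pair j :
  umbral theta_coef (node_poly j) = 0 /\
  umbral theta_coef ('X * node_poly j) = (-1) ^+ j.+1 * j`!%:R ^+ 2.
Proof.
have Xnode i : umbral theta_coef (node_poly i) = 0 ->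
    umbral theta_coef ('X * node_poly i) = (-1) ^+ i.+1 * i`!%:R ^+ 2.
  move=> i0; have := umbral_theta_shift (sym_poly i).
  rewrite sym_poly_coef1 translate_sym_poly sym_poly_node.
  have -> : node_poly i * ('X + i.+1%:R) + node_poly i * ('X - i%:R)
          = 2 *: ('X * node_poly i) + node_poly i.
    by rewrite -natr1 scaler_nat; ring.
  rewrite linearD linearZ /= i0 addr0 => /(congr1 (fun z => 2^-1 * z)).
  by rewrite mulKf // => ->; rewrite [(-1) ^+ i.+1]exprS; field.
suff e : umbral theta_coef (node_poly j) = 0 by split=> //; exact: Xnode.
elim: j => [|j IHj].
  by rewrite /node_poly big_ord0 -(expr0 'X) umbralXn /theta_coef expr1 subrr mul0r.
have := umbral_theta_shift ('X * sym_poly j).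
rewrite coefXM /= sym_poly_coef0 mulr0 comp_polyM comp_polyX translate_sym_poly sym_poly_node.
have -> : ('X + 1) * (node_poly j * ('X + j.+1%:R)) + 'X * (node_poly j * ('X - j%:R))
        = 2 *: node_poly j.+1 + ((2 * j + 1) * j.+1)%:R *: node_poly j.
  by rewrite !scaler_nat node_polyS -[node_poly j *+ _]mulr_natr natrM natrD natrM -natr1; ring.
by rewrite linearD !linearZ /= IHj mulr0 addr0 => /eqP; rewrite mulf_eq0 /= => /eqP.
Qed.

Lemma umbral_theta_node j : umbral theta_coef (node_poly j) = 0.
Proof. by have [] := umbral_theta_node_pair j. Qed.

Lemma umbral_theta_Xnode j :
  umbral theta_coef ('X * node_poly j) = (-1) ^+ j.+1 * j`!%:R ^+ 2.
Proof. by have [] := umbral_theta_node_pair j. Qed.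

Lemma node_poly_monic j : node_poly j \is monic.
Proof.
apply: monic_prod => i _; rewrite monicMl -?polyC_natr ?monicXsubC //.
by rewrite -[_%:P]opprK -polyCN monicXsubC.
Qed.

Lemma size_node_poly j : size (node_poly j) = (j.*2).+1.
Proof.
elim: j => [|j IHj]; first by rewrite /node_poly big_ord0 size_poly1.
have m : ('X + j.+1%:R) * ('X - j%:R) \is @monic rat.
  rewrite monicMl -?polyC_natr ?monicXsubC //.
  by rewrite -[_%:P]opprK -polyCN monicXsubC.
rewrite node_polyS size_Mmonic ?monic_neq0 ?node_poly_monic // IHj.
rewrite size_Mmonic -?polyC_natr ?size_XsubC ?monicXsubC ?polyXsubC_neq0 //.
  by rewrite -[_%:P]opprK -polyCN size_XsubC !addnS addn0.
by rewrite -[_%:P]opprK -polyCN polyXsubC_eq0.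
Qed.

Lemma int_polyM (f g : {poly rat}) : f \is a polyOver Num.int ->
  g \is a polyOver Num.int -> f * g \is a polyOver Num.int.
Proof.
move=> /polyOverP fZ /polyOverP gZ; apply/polyOverP => i.
by rewrite coefM rpred_sum // => j _; rewrite rpredM.
Qed.

Lemma int_polyX : 'X \is a polyOver (Num.int : {pred rat}).
Proof. by apply/polyOverP => i; rewrite coefX rpred_nat. Qed.

Lemma node_poly_int j : node_poly j \is a polyOver Num.int.
Proof.
elim: j => [|j IHj].
  by apply/polyOverP => i; rewrite /node_poly big_ord0 coef1 rpred_nat.
rewrite node_polyS -!polyC_natr; do 2?apply: int_polyM => //; apply/polyOverP => i.
  by rewrite coefD coefX coefC rpredD ?rpred_nat //; case: ifP; rewrite ?rpred0 ?rpred_nat.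
by rewrite coefB coefX coefC rpredB ?rpred_nat //; case: ifP; rewrite ?rpred0 ?rpred_nat.
Qed.

(** Integral polynomials are integral combinations of the monic integral polynomials
    node_poly j and y node_poly j, of degrees 2j and 2j+1, on which the functional
    is integral.  For the monomials this says that the t_n are integers (they are
    Genocchi numbers up to sign). *)
Lemma umbral_theta_int f : f \is a polyOver Num.int ->
  umbral theta_coef f \is a Num.int.
Proof.
have [n] := ubnP (size f); elim: n => // n IHn in f *; rewrite ltnS => fn fZ.
case: n => [|n] in IHn fn.
  by move: fn; rewrite leqn0 size_poly_eq0 => /eqP ->; rewrite linear0.
pose N : {poly rat} := if odd n then 'X * node_poly n./2 else node_poly n./2.
have Nm : N \is monic.
  by rewrite /N; case: ifP => _; rewrite ?monicMl ?monicX ?node_poly_monic.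
have NZ : N \is a polyOver Num.int.
  by rewrite /N; case: ifP => _; rewrite ?int_polyM ?int_polyX ?node_poly_int.
have sN : size N = n.+1.
  rewrite /N; case: ifP => on; last by rewrite size_node_poly -[in RHS](odd_double_half n) on.
  rewrite mulrC size_mulX ?monic_neq0 ?node_poly_monic // size_node_poly.
  by rewrite -[in RHS](odd_double_half n) on.
have GN : umbral theta_coef N \is a Num.int.
  rewrite /N; case: ifP => _; rewrite ?umbral_theta_node ?rpred0 //.
  by rewrite umbral_theta_Xnode rpredM ?rpredX ?rpredN ?rpred1 ?rpred_nat.
rewrite -(subrK (f`_n *: N) f) linearD rpredD //=; last first.
  by rewrite linearZ rpredM //; exact: (polyOverP fZ).
apply: IHn.
  rewrite ltnS; apply/leq_sizeP => j; rewrite leq_eqVlt coefB coefZ.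
  case/predU1P => [<-|nj].
    by have /monicP := Nm; rewrite /lead_coef sN /= => ->; rewrite mulr1 subrr.
  by rewrite (nth_default _ (leq_trans fn nj)) (@nth_default _ _ N) ?mulr0 ?subrr ?sN.
by apply/polyOverP => i; rewrite coefB coefZ rpredB ?rpredM //; apply: (polyOverP _).
Qed.

(** * Two expansions of the kernel 1/(x+y) *)

(** The argument -x appears because 1/(x+y) has its pole at y = -x. *)
Definition node_val (x : rat) (j : nat) : rat := (node_poly j).[- x].

Lemma node_valE x j :
  node_val x j = \prod_(i < j) ((x - i.+1%:R) * (x + i%:R)).
Proof.
rewrite /node_val horner_prod; apply: eq_bigr => i _.
by rewrite -!polyC_natr hornerM !(hornerD, hornerN, hornerX, hornerC); ring.
Qed.

Lemma node_val0 x : node_val x 0 = 1.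
Proof. by rewrite node_valE big_ord0. Qed.

Lemma node_valS x j :
  node_val x j.+1 = node_val x j * ((x - j.+1%:R) * (x + j%:R)).
Proof. by rewrite !node_valE big_ord_recr. Qed.

Definition theta_sum (x : rat) (n : nat) : rat :=
  \sum_(j < n) theta_coef j * (- x^-1) ^+ j.+1.

(** A partial sum of the inverse factorial series.  Its terms are the values of the
    functional on those of the Newton expansion [newton_kernel]. *)
Definition inverse_factorial_sum (x : rat) (n : nat) : rat :=
  \sum_(j < n) (-1) ^+ j.+1 * j`!%:R ^+ 2 / node_val x j.+1.

(** Truncation of -1/(x+y) = sum_j (-1/x)^(j+1) y^j. *)
Definition theta_kernel (x : rat) (n : nat) : {poly rat} :=
  \sum_(j < n) (- x^-1) ^+ j.+1 *: 'X^j.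

(** Truncation of the Newton expansion of -1/(x+y); the terms of index 2j and 2j+1
    are grouped, which gives the factor y + 1 - x. *)
Definition newton_kernel (x : rat) (n : nat) : {poly rat} :=
  \sum_(j < n) (node_val x j.+1)^-1 *: (('X + (1 - x)%:P) * node_poly j).

Lemma umbral_theta_kernel x n : umbral theta_coef (theta_kernel x n) = theta_sum x n.
Proof.
rewrite /theta_kernel linear_sum; apply: eq_bigr => j _.
by rewrite linearZ /= umbralXn mulrC.
Qed.

Lemma umbral_newton_kernel x n :
  umbral theta_coef (newton_kernel x n) = inverse_factorial_sum x n.
Proof.
rewrite /newton_kernel linear_sum; apply: eq_bigr => j _.
rewrite linearZ /= mulrDl mul_polyC linearD linearZ /= umbral_theta_node.
by rewrite umbral_theta_Xnode mulr0 addr0 mulrC.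
Qed.

Lemma theta_kernelE x n : x != 0 ->
  ('X + x%:P) * theta_kernel x n = (- x^-1) ^+ n *: 'X^n - 1.
Proof.
move=> x0; elim: n => [|n IHn].
  by rewrite /theta_kernel big_ord0 mulr0 expr0 scale1r subrr.
rewrite /theta_kernel big_ord_recr /= mulrDr IHn -!mul_polyC !exprS !polyCM polyCN.
have : x%:P * (x^-1)%:P = 1 :> {poly rat} by rewrite -polyCM divff.
move: (x%:P) (x^-1)%:P (((- x^-1) ^+ n)%:P) => a b c ab.
have -> : ('X + a) * (- b * c * 'X^n) = - (b * c * ('X * 'X^n)) - (a * b) * c * 'X^n by ring.
by rewrite ab; ring.
Qed.

(** The sum telescopes, since
    N_(j+1)(y)/N_(j+1)(-x) - N_j(y)/N_j(-x)
      = N_j(y) (y + x)(y + 1 - x)/N_(j+1)(-x). *)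
Lemma newton_kernelE x n : (forall j, node_val x j != 0) ->
  ('X + x%:P) * newton_kernel x n = (node_val x n)^-1 *: node_poly n - 1.
Proof.
move=> x0; elim: n => [|n IHn].
  by rewrite /newton_kernel big_ord0 mulr0 node_val0 invr1 scale1r /node_poly big_ord0 subrr.
rewrite /newton_kernel big_ord_recr /= mulrDr IHn node_polyS.
have e : (node_val x n)^-1 = (node_val x n.+1)^-1 * ((x - n.+1%:R) * (x + n%:R)).
  have := x0 n.+1; rewrite [node_val x n.+1]node_valS mulf_eq0 negb_or => /andP[_ l0].
  by rewrite invfM divfK.
rewrite e -!mul_polyC !(polyCM, polyCD, polyCN, polyC_natr, polyC1) -natr1.
move: (x%:P) ((node_val x n.+1)^-1)%:P (node_poly n) => a b c; ring.
Qed.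

(** * The p-adic absolute value of rational numbers *)

Lemma padic_absX p x n : padic_abs p (x ^+ n) = padic_abs p x ^+ n.
Proof.
elim: n => [|n IHn]; first by rewrite !expr0 padic_abs1.
by rewrite !exprS padic_absM IHn.
Qed.

Lemma padic_absV p x : padic_abs p x^-1 = (padic_abs p x)^-1.
Proof.
have [->|x0] := eqVneq x 0; first by rewrite padic_abs0 !invr0 padic_abs0.
have ax0 : padic_abs p x != 0 by rewrite padic_abs_eq0.
by apply: (mulfI ax0); rewrite -padic_absM !divff // padic_abs1.
Qed.

Lemma padic_abs_intr p (m : int) : m != 0 ->
  padic_abs p m%:~R = (p%:R ^+ logn p `|m|%N)^-1.
Proof.
move=> m0; rewrite /padic_abs intr_eq0 (negPf m0) /padic_val numq_int denq_int.
by rewrite logn1 subr0 -invr_expz exprnP.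
Qed.

Lemma padic_abs_natr p (m : nat) : (0 < m)%N ->
  padic_abs p m%:R = (p%:R ^+ logn p m)^-1.
Proof. by move=> m0; rewrite (@padic_abs_intr p m%:Z) // eqz_nat -lt0n. Qed.

Lemma padic_abs_int p x : prime p -> x \is a Num.int -> padic_abs p x <= 1.
Proof.
move=> pp /intrP[m ->]; have [->|m0] := eqVneq m 0; first by rewrite padic_abs0.
rewrite padic_abs_intr // invf_le1 ?exprn_gt0 ?ltr0n ?prime_gt0 //.
by rewrite exprn_ege1 // ler1n prime_gt0.
Qed.

Lemma padic_abs_nat p n : prime p -> padic_abs p n%:R <= 1.
Proof. by move=> pp; rewrite padic_abs_int // rpred_nat. Qed.

Lemma padic_abs_sign p n x : padic_abs p ((-1) ^+ n * x) = padic_abs p x.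
Proof. by rewrite padic_absM padic_absX padic_absN padic_abs1 expr1n mul1r. Qed.

Lemma padic_abs_addl p x y : padic_abs p y < padic_abs p x ->
  padic_abs p (x + y) = padic_abs p x.
Proof. by move=> yx; apply: padic_abs_eqr; rewrite addrAC subrr add0r. Qed.

Lemma padic_abs_subr_le p x y c :
  padic_abs p x <= c -> padic_abs p y <= c -> padic_abs p (x - y) <= c.
Proof. by move=> xc yc; apply: le_trans (padic_absB _ _ _) _; rewrite ge_max xc. Qed.

Lemma padic_abs_add_le p x y c :
  padic_abs p x <= c -> padic_abs p y <= c -> padic_abs p (x + y) <= c.
Proof. by move=> xc yc; apply: le_trans (padic_absD _ _ _) _; rewrite ge_max xc. Qed.

Lemma padic_abs_sum_le p n (f : nat -> rat) c : 0 <= c ->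
  (forall i, (i < n)%N -> padic_abs p (f i) <= c) -> padic_abs p (\sum_(i < n) f i) <= c.
Proof.
move=> c0; elim: n => [|n IHn] fc; first by rewrite big_ord0 padic_abs0.
rewrite big_ord_recr /=; apply: padic_abs_add_le; last exact: fc.
by apply: IHn => i ni; apply: fc; rewrite ltnS ltnW.
Qed.

Lemma rat_lt_exp2 (x : rat) : exists n, x < 2 ^+ n.
Proof.
exists (Num.truncn x).+1; apply: lt_trans (truncnS_gt x) _.
by rewrite -natrX ltr_nat ltn_expl.
Qed.

Lemma exp_small (c e : rat) : 2 <= c -> 0 < e ->
  exists N, forall n, (N <= n)%N -> (c ^+ n)^-1 < e.
Proof.
move=> c2 e0; have [N eN] := rat_lt_exp2 e^-1; exists N => n Nn.
have c1 : 1 <= c by apply: le_trans c2.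
have c0 : 0 < c by apply: lt_le_trans c1.
rewrite invf_plt ?posrE ?exprn_gt0 //; apply: lt_le_trans eN _.
apply: le_trans (_ : c ^+ N <= _); first by rewrite lerXn2r ?nnegrE // ltW.
by rewrite ler_weXn2l.
Qed.

(** * The inverse factorial series and the Bernoulli series agree p-adically *)

Section Comparison.
Context (p : nat) (x : rat) (p_prime : prime p) (x_ge2 : 2 <= padic_abs p x).
Local Notation ax := (padic_abs p x).

Let ax_gt0 : 0 < ax. Proof. exact: lt_le_trans x_ge2. Qed.
Let ax_ge1 : 1 <= ax. Proof. exact: le_trans x_ge2. Qed.

Lemma padic_abs_addn n : padic_abs p (x + n%:R) = ax.
Proof.
apply: padic_abs_addl; apply: le_lt_trans (padic_abs_nat n p_prime) _.
exact: lt_le_trans x_ge2.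
Qed.

Lemma padic_abs_subn n : padic_abs p (x - n%:R) = ax.
Proof.
apply: padic_abs_addl; rewrite padic_absN.
by apply: le_lt_trans (padic_abs_nat n p_prime) _; apply: lt_le_trans x_ge2.
Qed.

Lemma padic_abs_node_val j : padic_abs p (node_val x j) = ax ^+ j.*2.
Proof.
elim: j => [|j IHj]; first by rewrite node_val0 padic_abs1.
by rewrite node_valS !padic_absM IHj padic_abs_subn padic_abs_addn doubleS !exprSr mulrA.
Qed.

Lemma node_val_neq0 j : node_val x j != 0.
Proof. by rewrite -(padic_abs_eq0 p) padic_abs_node_val expf_eq0 (gt_eqF ax_gt0) andbF. Qed.

(** When |x|_p > 1, division by y + x from the constant coefficient upwards does not
    increase the Gauss norm. *)
Lemma linear_quotient_coef (E : {poly rat}) c i : 0 <= c ->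
  (forall k, padic_abs p (('X + x%:P) * E)`_k <= c) -> padic_abs p E`_i <= c.
Proof.
move=> c0 Hc.
have step z : padic_abs p (x * z) <= c -> padic_abs p z <= c.
  rewrite padic_absM => h; apply: le_trans h.
  by rewrite ler_peMl ?padic_abs_ge0.
elim: i => [|i IHi]; apply: step.
  by have := Hc 0%N; rewrite mulrDl coefD coefXM coefCM add0r.
have := Hc i.+1; rewrite mulrDl coefD coefXM coefCM /= => h.
have -> : x * E`_i.+1 = E`_i + x * E`_i.+1 - E`_i by ring.
exact: padic_abs_subr_le.
Qed.

(** Both sums are values of the functional, on two truncations of -1/(x+y).  Times
    y + x, the difference of the truncations is
    (y/x)^(2J) - N_J(y)/N_J(-x), whose coefficients are at most |x|^(-2J).
    Dividing by y + x and applying the integral functional keep this bound. *)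
Lemma theta_inverse_factorial_close J :
  padic_abs p (theta_sum x J.*2 - inverse_factorial_sum x J) <= (ax ^+ J.*2)^-1.
Proof.
have x0 : x != 0 by rewrite -(padic_abs_eq0 p) gt_eqF.
rewrite -umbral_theta_kernel -umbral_newton_kernel -linearB /umbral.
set c := (ax ^+ J.*2)^-1; have c0 : 0 <= c by rewrite invr_ge0 exprn_ge0 // ltW.
set E := theta_kernel x J.*2 - newton_kernel x J.
apply: (@padic_abs_sum_le p _ (fun i => E`_i * theta_coef i)) => // i _.
have tZ : padic_abs p (theta_coef i) <= 1.
  rewrite -umbralXn padic_abs_int // umbral_theta_int //.
  by apply/polyOverP => k; rewrite coefXn rpred_nat.
rewrite padic_absM; apply: le_trans (_ : padic_abs p E`_i <= _).
  by rewrite ler_piMr ?padic_abs_ge0.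
apply: linear_quotient_coef => // k.
rewrite mulrBr theta_kernelE // newton_kernelE; last exact: node_val_neq0.
rewrite opprB addrA subrK coefB !coefZ; apply: padic_abs_subr_le.
  rewrite padic_absM padic_absX padic_absN padic_absV coefXn exprVn -/c.
  by rewrite ler_piMr // padic_abs_nat.
rewrite padic_absM padic_absV padic_abs_node_val -/c ler_piMr //.
by rewrite padic_abs_int //; apply: (polyOverP (node_poly_int J)).
Qed.

Lemma theta_sum_tail m n : (m <= n)%N ->
  padic_abs p (theta_sum x n - theta_sum x m) <= (ax ^+ m)^-1.
Proof.
have c0 k : 0 <= (ax ^+ k)^-1 by rewrite invr_ge0 exprn_ge0 // ltW.
elim: n => [|n IHn]; first by rewrite leqn0 => /eqP ->; rewrite subrr padic_abs0.
rewrite leq_eqVlt => /predU1P[->|]; first by rewrite subrr padic_abs0.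
rewrite ltnS => mn; rewrite /theta_sum big_ord_recr /= -/(theta_sum x n) addrAC.
apply: padic_abs_add_le; first exact: IHn.
rewrite padic_absM padic_absX padic_absN padic_absV exprVn.
apply: le_trans (_ : (ax ^+ n.+1)^-1 <= _).
  rewrite ler_piMl // -umbralXn padic_abs_int // umbral_theta_int //.
  by apply/polyOverP => k; rewrite coefXn rpred_nat.
by rewrite lef_pV2 ?posrE ?exprn_gt0 // ler_weXn2l // ltnW.
Qed.

Lemma theta_sum_cauchy : theta_sum x \in padic_cauchy p.
Proof.
apply/asboolP => e e0; have [N Ne] := exp_small x_ge2 e0; exists N => m n Nm Nn.
apply: le_lt_trans (Ne N (leqnn N)).
have -> : theta_sum x m - theta_sum x n
  = (theta_sum x m - theta_sum x N) - (theta_sum x n - theta_sum x N) by ring.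
by apply: padic_abs_subr_le; apply: theta_sum_tail.
Qed.
End Comparison.

Section ThetaLimit.
Local Open Scope classical_set_scope.

Lemma Theta_partial_sum p (a : int) (F : nat) n :
  series (fun n => ratr (theta_coef n) * (- (F%:R / a%:~R)) ^+ n.+1 : Qp p) n
  = ratr (theta_sum (a%:~R / F%:R) n).
Proof.
pose phi : {rmorphism rat -> Qp p} := @Qp_class p \o padic_cst p.
have rE q : ratr q = phi q := ratr_Qp p q.
rewrite /series /= big_mkord /theta_sum rE rmorph_sum.
apply: eq_bigr => i _; rewrite rE [RHS]rmorphM; congr (_ * _).
rewrite rmorphXn rmorphN /=; congr ((- _) ^+ _).
by rewrite invf_div -[RHS]/(phi _) fmorph_div rmorph_nat rmorph_int.
Qed.

(** Transports the hypothesis from the completion to rational numbers: from here on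
    only rational numbers and their p-adic absolute values occur. *)
Lemma Theta_rational_cvg p (a : int) (F : nat) (xi : rat) : prime p ->
  2 <= padic_abs p (a%:~R / F%:R) -> Theta p a F = ratr xi ->
  forall e : rat, 0 < e -> exists N, forall n, (N <= n)%N ->
    padic_abs p (theta_sum (a%:~R / F%:R) n - xi) < e.
Proof.
move=> pp x2 Txi e e0; set x := a%:~R / F%:R in x2 *.
pose l : Qp p := Qp_class (exist (fun v => v \in padic_cauchy p) _ (theta_sum_cauchy pp x2)).
pose s : nat -> Qp p :=
  series (fun n => ratr (theta_coef n) * (- (F%:R / a%:~R)) ^+ n.+1 : Qp p).
have sE n : s n = ratr (theta_sum x n) by exact: Theta_partial_sum.
have sl : s @ \oo --> l.
  apply/fcvg_ballP => d d0; have [N Nd] := exp_small x2 d0.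
  exists N => // n /= Nn; rewrite Qp_ballE /= sE ratr_Qp -rmorphB.
  apply/(Qp_abs_ltP _ d0); exists n => m nm /=; rewrite !fctE.
  by apply: le_lt_trans (theta_sum_tail pp x2 nm) _; apply: Nd.
have sc : cvgn s by apply/cvg_ex; exists l.
have : s @ \oo --> (ratr xi : Qp p) by rewrite -Txi.
move=> /fcvg_ballP/(_ e e0)[N _ Ne]; exists N => n Nn.
have := Ne n Nn; rewrite Qp_ballE /= sE.
by rewrite -Qp_absN opprB -ratr_Qp_is_zmod_morphism Qp_abs_ratr.
Qed.
End ThetaLimit.

(** * Binomial sums and a three-term recurrence *)

Definition binomial_sum (w : nat -> rat) (n : nat) : rat :=
  \sum_(k < n.+1) 'C(n, k)%:R * w k.

Lemma eq_binomial_sum v w n : v =1 w -> binomial_sum v n = binomial_sum w n.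
Proof. by move=> vw; apply: eq_bigr => k _; rewrite vw. Qed.

Lemma binomial_sumD v w n :
  binomial_sum (fun k => v k + w k) n = binomial_sum v n + binomial_sum w n.
Proof. by rewrite -big_split; apply: eq_bigr => k _; rewrite mulrDr. Qed.

Lemma binomial_sumZ c w n :
  binomial_sum (fun k => c * w k) n = c * binomial_sum w n.
Proof. by rewrite /binomial_sum mulr_sumr; apply: eq_bigr => k _; rewrite mulrCA. Qed.

Lemma binomial_sumS w n :
  binomial_sum w n.+1 = binomial_sum w n + binomial_sum (fun k => w k.+1) n.
Proof.
have -> : binomial_sum w n = w 0%N + \sum_(k < n.+1) 'C(n, k.+1)%:R * w k.+1.
  rewrite /binomial_sum big_ord_recl bin0 mul1r big_ord_recr /=.
  by rewrite (bin_small (leqnn n.+1)) mul0r addr0.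
rewrite /binomial_sum big_ord_recl bin0 mul1r -addrA -big_split.
by congr (_ + _); apply: eq_bigr => k _; rewrite /= binS natrD mulrDl.
Qed.

Lemma binomial_sum_absorb w n :
  binomial_sum (fun k => k%:R * w k) n.+1 = n.+1%:R * binomial_sum (fun k => w k.+1) n.
Proof.
rewrite /binomial_sum big_ord_recl mul0r mulr0 add0r mulr_sumr.
apply: eq_bigr => k _; rewrite /= mulrA mulrA -!natrM mul_bin_diag.
by congr (_%:R * _); apply: mulnC.
Qed.

Lemma binomial_sum_sign n : binomial_sum (fun k => (-1) ^+ k) n = (n == 0%N)%:R.
Proof.
rewrite -expr0n -[X in X ^+ n](subrr (1 : rat)) exprDn.
by apply: eq_bigr => k _; rewrite expr1n mul1r mulr_natl.
Qed.

(** The relation at n = 0 is inhomogeneous, the term 1 coming from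
    sum_k (-1)^k C(n,k) = [n = 0].  It rules out the zero solution. *)
Definition theta_recurrence (lam : rat) (R : nat -> rat) : Prop :=
  R 1%N - R 0%N = lam * R 0%N + 1 /\
  forall n, n.+2%:R ^+ 2 * (R n.+2 - R n.+1)
    = n.+1%:R ^+ 2 * (R n.+1 - R n) + lam * R n.+1.

(** Under the binomial transform the second-order difference operator of
    [theta_recurrence] becomes the first-order one of the hypothesis.  By the
    absorption identity, D_n = n sum_k k C(n,k) w_k equals n^2 (R_n - R_(n-1)),
    and D_(n+1) - D_n is again a binomial sum. *)
Lemma binomial_sum_recurrence lam w :
  (forall k, k.+1%:R ^+ 2 * w k.+1 = (lam - k%:R * k.+1%:R) * w k + (-1) ^+ k) ->
  theta_recurrence lam (binomial_sum w).
Proof.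
move=> wE; set u := binomial_sum w.
pose v k : rat := k%:R * w k; pose D n := n%:R * binomial_sum v n.
have D1 n : D n.+1 = n.+1%:R ^+ 2 * (u n.+1 - u n).
  by rewrite /D binomial_sum_absorb /u binomial_sumS; ring.
have D2 n : D n.+1 = D n + lam * u n + (n == 0%N)%:R.
  have -> : D n.+1 = D n + (binomial_sum v n + (binomial_sum (fun k => k%:R * v k) n
                        + binomial_sum (fun k => k.+1%:R * v k.+1) n)).
    rewrite -(binomial_sumS (fun k => k%:R * v k)) binomial_sum_absorb.
    by rewrite /D binomial_sumS -natr1; ring.
  rewrite -addrA; congr (_ + _).
  rewrite -binomial_sum_sign /u -binomial_sumZ -!binomial_sumD.
  apply: eq_binomial_sum => k.
  have -> : k.+1%:R * v k.+1 = k.+1%:R ^+ 2 * w k.+1 by rewrite /v; ring.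
  by rewrite wE /v -natr1; ring.
split=> [|n].
  by have := D1 0%N; rewrite D2 {1}/D mul0r add0r eqxx expr1n mul1r => <-.
by rewrite -!D1 D2 /= addr0.
Qed.

(** Two consecutive zeros propagate backwards to R_0 = R_1 = 0, against the
    inhomogeneous relation. *)
Lemma theta_recurrence_neq0 lam R n : theta_recurrence lam R ->
  (R n != 0) || (R n.+1 != 0).
Proof.
move=> [R1 RS]; rewrite -negb_and; apply/negP.
elim: n => [|n IHn] /andP[/eqP Rn /eqP Rn1].
  by move: R1; rewrite Rn Rn1 mulr0 subrr add0r => /eqP; rewrite eq_sym oner_eq0.
apply: IHn; rewrite Rn eqxx andbT; have := RS n.
rewrite Rn Rn1 subrr !mulr0 addr0 sub0r => /esym/eqP.
by rewrite mulf_eq0 oppr_eq0 expf_eq0 pnatr_eq0.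
Qed.

(** The quantity |R_(n+1)| + (n+1) |R_(n+1) - R_n| is multiplied at each step by at
    most 1 + 2|lam|/(n+2), and the product of these factors is polynomial in n. *)
Lemma theta_recurrence_growth lam R : theta_recurrence lam R ->
  exists C K, forall n, `|R n| <= C * n.+1%:R ^+ K.
Proof.
move=> [_ RS]; pose L := `|lam|; pose K := (Num.truncn (2 * L)).+1.
have LK : 2 * L <= K%:R by apply: ltW; apply: truncnS_gt.
pose g n := `|R n.+1| + n.+1%:R * `|R n.+1 - R n|.
have g0 n : 0 <= g n by rewrite addr_ge0 // mulr_ge0.
have gS n : g n.+1 <= g n * (1 + K%:R / n.+2%:R).
  set N : rat := n.+2%:R; have N0 : 0 < N by rewrite ltr0n.
  have N1 : 1 <= N by rewrite ler1n.
  set d := n.+1%:R * `|R n.+1 - R n|; set r := `|R n.+1|.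
  have r0 : 0 <= r := normr_ge0 _. have d0 : 0 <= d by rewrite mulr_ge0.
  have L0 : 0 <= L := normr_ge0 _.
  set s := `|R n.+2 - R n.+1|.
  have hs : N ^+ 2 * s <= (N - 1) * d + L * r.
    have NN : `|N ^+ 2| = N ^+ 2 by rewrite ger0_norm // exprn_ge0 // ltW.
    rewrite /s -{1}NN -normrM RS.
    apply: le_trans (ler_normD _ _) _; rewrite !normrM -/L -/r lerD2r.
    rewrite /d ?normr_nat -mulrA.
    have -> // : N - 1 = n.+1%:R by rewrite /N -[n.+2%:R]natr1 addrK.
  have hr : `|R n.+2| <= r + s.
    by rewrite -[R n.+2](subrK (R n.+1)) addrC; apply: ler_normD.
  have gE : g n.+1 = `|R n.+2| + N * s by [].
  have gn : g n = r + d by [].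
  rewrite gE gn; apply: (@le_trans _ _ (r + (1 + N) * s)); first by lra.
  have hs2 : s <= ((N - 1) * d + L * r) / N ^+ 2.
    by rewrite ler_pdivlMr ?exprn_gt0 // mulrC.
  apply: (@le_trans _ _ (r + (1 + N) * (((N - 1) * d + L * r) / N ^+ 2))).
    by rewrite lerD2l ler_wpM2l //; lra.
  rewrite -subr_ge0.
  have -> : (r + d) * (1 + K%:R / N) - (r + (1 + N) * (((N - 1) * d + L * r) / N ^+ 2))
    = (d + d * K%:R * N + r * (K%:R * N - (1 + N) * L)) / N ^+ 2.
    by field; rewrite gt_eqF.
  apply: divr_ge0; last by rewrite exprn_ge0 // ltW.
  have : 0 <= K%:R * N - (1 + N) * L.
    have : 2 * L * N <= K%:R * N by rewrite ler_wpM2r // ltW.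
    have : 0 <= (N - 1) * L by rewrite mulr_ge0 // subr_ge0.
    lra.
  move=> h; rewrite addr_ge0 ?addr_ge0 //; first by rewrite !mulr_ge0 // ltW.
  exact: mulr_ge0.
have bern (y : rat) k : 0 <= y -> 1 + k%:R * y <= (1 + y) ^+ k.
  move=> y0; elim: k => [|k IHk]; first by rewrite mul0r addr0 expr0.
  rewrite exprS -natr1; apply: (@le_trans _ _ ((1 + y) * (1 + k%:R * y))).
    have : 0 <= k%:R * y * y by rewrite !mulr_ge0.
    lra.
  by rewrite ler_wpM2l // addr_ge0.
have gb n : g n <= g 0%N * n.+2%:R ^+ K.
  elim: n => [|n IHn]; first by rewrite ler_peMr // exprn_ege1 // ler1n.
  apply: le_trans (gS n) _.
  apply: (@le_trans _ _ (g 0%N * n.+2%:R ^+ K * (1 + n.+2%:R^-1) ^+ K)).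
    by apply: ler_pM => //; apply: bern; rewrite invr_ge0.
  rewrite -mulrA -exprMn; have -> // : n.+2%:R * (1 + n.+2%:R^-1) = n.+3%:R :> rat.
  by rewrite mulrDr divff ?pnatr_eq0 // mulr1 natr1.
exists (`|R 0%N| + g 0%N), K => -[|n].
  by rewrite expr1n mulr1 lerDl.
apply: (@le_trans _ _ (g n)); first by rewrite lerDl mulr_ge0.
apply: le_trans (gb n) _; rewrite ler_wpM2r ?exprn_ge0 // lerDr //.
Qed.

(** If |lam R_(n+1)| > |(n+1)^2 R_n| for some n, then the ultrametric inequality
    makes lam R_(n+1) dominate the recurrence, so |R_(n+2)| >= |lam R_(n+1)|; the
    same inequality then holds at n+1, and R grows geometrically, which
    boundedness excludes.  Hence |R_(n+1)| <= |(n+1)^2/lam| |R_n| for all n. *)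
Lemma theta_recurrence_minimal p lam R : prime p -> 2 <= padic_abs p lam ->
  theta_recurrence lam R -> (forall n, padic_abs p (R n) <= 1) ->
  forall n, padic_abs p (R n) <=
    padic_abs p n`!%:R ^+ 2 / padic_abs p lam ^+ n * padic_abs p (R 0%N).
Proof.
move=> pp lam2 [_ RS] Rb; set L := padic_abs p lam in lam2 *.
have L0 : 0 < L by apply: lt_le_trans lam2.
have dom n : L * padic_abs p (R n.+1) <= padic_abs p (n.+1%:R ^+ 2 * R n).
  rewrite leNgt; apply/negP => viol.
  pose V m := padic_abs p (m.+1%:R ^+ 2 * R m) < L * padic_abs p (R m.+1).
  have step m : V m -> L * padic_abs p (R m.+1) <= padic_abs p (R m.+2).
    move=> Vm; have N1 : padic_abs p (m.+2%:R ^+ 2 + m.+1%:R ^+ 2) <= 1.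
      by rewrite -!natrX -natrD padic_abs_nat.
    have lamN : padic_abs p (lam + (m.+2%:R ^+ 2 + m.+1%:R ^+ 2)) = L.
      by apply: padic_abs_addl; apply: le_lt_trans N1 _; apply: lt_le_trans lam2.
    have e : m.+2%:R ^+ 2 * R m.+2 =
        (lam + (m.+2%:R ^+ 2 + m.+1%:R ^+ 2)) * R m.+1 - m.+1%:R ^+ 2 * R m.
      have -> : m.+2%:R ^+ 2 * R m.+2
        = m.+2%:R ^+ 2 * (R m.+2 - R m.+1) + m.+2%:R ^+ 2 * R m.+1 by ring.
      by rewrite RS; ring.
    have : padic_abs p (m.+2%:R ^+ 2 * R m.+2) = L * padic_abs p (R m.+1).
      by rewrite e padic_abs_addl padic_absM lamN // padic_absN.
    rewrite padic_absM => <-; rewrite ler_piMl ?padic_abs_ge0 //.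
    by rewrite -natrX padic_abs_nat.
  have VS m : V m -> V m.+1.
    move=> Vm; have R1 : 0 < padic_abs p (R m.+1).
      have := le_lt_trans (padic_abs_ge0 _ _) Vm.
      by rewrite pmulr_rgt0.
    rewrite /V padic_absM; apply: (@le_lt_trans _ _ (padic_abs p (R m.+1))).
      by rewrite ler_piMl ?padic_abs_ge0 // -natrX padic_abs_nat.
    apply: (@lt_le_trans _ _ (L * (L * padic_abs p (R m.+1)))); last first.
      by rewrite ler_wpM2l ?step // ltW.
    rewrite mulrA ltr_pMl //; nra.
  have VD i : V (n + i)%N.
    by elim: i => [|i IHi]; rewrite ?addn0 // addnS; apply: VS.
  have grow i : 2 ^+ i * padic_abs p (R n.+1) <= padic_abs p (R (n + i).+1).
    elim: i => [|i IHi]; first by rewrite expr0 mul1r addn0.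
    rewrite addnS; apply: le_trans (step _ (VD i)).
    rewrite exprS -mulrA; apply: ler_pM => //.
    by rewrite mulr_ge0 ?exprn_ge0 ?padic_abs_ge0.
  have R1 : 0 < padic_abs p (R n.+1).
    have := le_lt_trans (padic_abs_ge0 _ _) viol.
    by rewrite pmulr_rgt0.
  have [i] := rat_lt_exp2 (padic_abs p (R n.+1))^-1.
  rewrite -(ltr_pM2r R1) mulVf ?gt_eqF // ltNge => /negP; apply.
  exact: le_trans (grow i) (Rb _).
elim=> [|n IHn]; first by rewrite fact0 padic_abs1 expr1n expr0 divr1 mul1r.
rewrite -(ler_pM2l L0); apply: le_trans (dom n) _.
rewrite padic_absM padic_absX factS natrM padic_absM exprMn [L ^+ n.+1]exprS invfM.
set a := padic_abs p n.+1%:R ^+ 2.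
have -> : L * (a * padic_abs p n`!%:R ^+ 2 * (L^-1 / L ^+ n) * padic_abs p (R 0%N))
  = a * (padic_abs p n`!%:R ^+ 2 / L ^+ n * padic_abs p (R 0%N)).
  by field; rewrite expf_eq0 !(gt_eqF L0) andbF.
by rewrite ler_wpM2l // exprn_ge0 // padic_abs_ge0.
Qed.

(** * The Pade remainders at a hypothetical rational value *)

(** The factor node_val x k / k!^2 is C(x-1,k) C(x-1+k,k). *)
Definition node_error (x xi : rat) (k : nat) : rat :=
  node_val x k / k`!%:R ^+ 2 * (xi - inverse_factorial_sum x k).

Definition remainder (x xi : rat) : nat -> rat := binomial_sum (node_error x xi).

Lemma remainder0 x xi : remainder x xi 0 = xi.
Proof.
rewrite /remainder /binomial_sum big_ord1 bin0 /node_error node_val0 fact0.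
by rewrite /inverse_factorial_sum big_ord0; field.
Qed.

Lemma remainder_recurrence x xi : (forall j, node_val x j != 0) ->
  theta_recurrence (x ^+ 2 - x) (remainder x xi).
Proof.
move=> v0; apply: binomial_sum_recurrence => k; rewrite /node_error.
have -> : inverse_factorial_sum x k.+1
  = inverse_factorial_sum x k + (-1) ^+ k.+1 * k`!%:R ^+ 2 / node_val x k.+1.
  by rewrite /inverse_factorial_sum big_ord_recr.
have -> : k.+1%:R ^+ 2 * (node_val x k.+1 / k.+1`!%:R ^+ 2 * (xi -
    (inverse_factorial_sum x k + (-1) ^+ k.+1 * k`!%:R ^+ 2 / node_val x k.+1)))
  = node_val x k.+1 / k`!%:R ^+ 2 * (xi - inverse_factorial_sum x k) + (-1) ^+ k.
  rewrite factS natrM [(-1) ^+ k.+1]exprS; field.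
  by rewrite fact_rat_neq0 v0 addrC natr1 pnatr_eq0.
by rewrite node_valS -natr1; congr (_ + _); ring.
Qed.

Lemma padic_abs_dvd p (d m : nat) : prime p -> (d %| m)%N ->
  padic_abs p m%:R <= padic_abs p d%:R.
Proof.
move=> pp /dvdnP[q ->]; rewrite natrM padic_absM ler_piMl ?padic_abs_ge0 //.
exact: padic_abs_nat.
Qed.

Lemma fact_dvd k j : (k <= j)%N -> (k`! %| j`!)%N.
Proof. by move=> kj; rewrite (fact_split kj) dvdn_mulr. Qed.

Section Remainder.
Context (p : nat) (x xi : rat) (p_prime : prime p) (x_ge2 : 2 <= padic_abs p x).
Hypothesis theta_cvg : forall e : rat, 0 < e -> exists N, forall n, (N <= n)%N ->
  padic_abs p (theta_sum x n - xi) < e.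
Local Notation ax := (padic_abs p x).

Let ax_gt0 : 0 < ax. Proof. exact: lt_le_trans x_ge2. Qed.
Let ax_ge1 : 1 <= ax. Proof. exact: le_trans x_ge2. Qed.

Lemma inverse_factorial_sum_tail k m : (k <= m)%N ->
  padic_abs p (inverse_factorial_sum x m - inverse_factorial_sum x k)
    <= padic_abs p k`!%:R ^+ 2 / ax ^+ k.*2.
Proof.
set c := _ / _; have c0 : 0 <= c by rewrite divr_ge0 ?exprn_ge0 ?padic_abs_ge0.
elim: m => [|m IHm]; first by rewrite leqn0 => /eqP ->; rewrite subrr padic_abs0.
rewrite leq_eqVlt => /predU1P[->|]; first by rewrite subrr padic_abs0.
rewrite ltnS => km; rewrite /inverse_factorial_sum big_ord_recr /=.
rewrite -/(inverse_factorial_sum x m) addrAC.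
apply: padic_abs_add_le; first exact: IHm.
rewrite -mulrA padic_abs_sign padic_absM padic_absX padic_absV padic_abs_node_val //.
apply: ler_pM; rewrite ?exprn_ge0 ?invr_ge0 ?exprn_ge0 ?padic_abs_ge0 //.
  rewrite lerXn2r ?nnegrE ?padic_abs_ge0 // padic_abs_dvd // fact_dvd //.
by rewrite lef_pV2 ?posrE ?exprn_gt0 // ler_weXn2l // leq_double ltnW.
Qed.

(** The tail estimate for the partial sums passes to the limit xi, which they share
    with the Bernoulli series. *)
Lemma inverse_factorial_sum_error k :
  padic_abs p (xi - inverse_factorial_sum x k) <= padic_abs p k`!%:R ^+ 2 / ax ^+ k.*2.
Proof.
set c := _ / _; have c0 : 0 < c.
  by rewrite divr_gt0 ?exprn_gt0 // lt_neqAle padic_abs_ge0 eq_sym padic_abs_eq0 fact_rat_neq0.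
have [N1 h1] := theta_cvg c0; have [N2 h2] := exp_small x_ge2 c0.
pose J := maxn k (maxn N1 N2).
have [kJ N1J N2J] : [/\ k <= J, N1 <= J & N2 <= J]%N.
  by rewrite /J !leq_max !leqnn !orbT.
have Jle i : (i <= J -> i <= J.*2)%N by move=> h; rewrite (leq_trans h) // -addnn leq_addr.
have -> : xi - inverse_factorial_sum x k = (inverse_factorial_sum x J - inverse_factorial_sum x k)
  - ((theta_sum x J.*2 - xi) - (theta_sum x J.*2 - inverse_factorial_sum x J)).
  by rewrite !opprB; ring.
apply: padic_abs_subr_le; first exact: inverse_factorial_sum_tail.
apply: padic_abs_subr_le; first by rewrite ltW // h1 // Jle.
by apply: le_trans (theta_inverse_factorial_close p_prime x_ge2 J) _; rewrite ltW // h2 // Jle.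
Qed.

(** The error of the k-th partial sum is at most |k!^2 / N_k(-x)|, which is just
    compensated by the factor in [node_error]. *)
Lemma remainder_bounded n : padic_abs p (remainder x xi n) <= 1.
Proof.
apply: (@padic_abs_sum_le p n.+1 (fun k => 'C(n, k)%:R * node_error x xi k)) => // k _.
rewrite padic_absM mulr_ile1 ?padic_abs_ge0 ?padic_abs_nat //.
have f0 : 0 < padic_abs p k`!%:R.
  by rewrite lt_neqAle padic_abs_ge0 eq_sym padic_abs_eq0 fact_rat_neq0.
rewrite !padic_absM padic_absV padic_absX padic_abs_node_val //.
have V0 : 0 < ax ^+ k.*2 by rewrite exprn_gt0.
apply: le_trans (ler_wpM2l _ (inverse_factorial_sum_error k)) _.
  by rewrite divr_ge0 ?exprn_ge0 // ltW.
by rewrite mulrA divfK ?expf_eq0 ?gt_eqF // divff // gt_eqF.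
Qed.

Lemma remainder_small n :
  padic_abs p (remainder x xi n)
    <= padic_abs p n`!%:R ^+ 2 / ax ^+ n.*2 * padic_abs p xi.
Proof.
have lamE : padic_abs p (x ^+ 2 - x) = ax ^+ 2.
  rewrite (_ : x ^+ 2 - x = x * (x - 1%:R)); last by rewrite mulrBr mulr1.
  by rewrite padic_absM padic_abs_subn // expr2.
have := @theta_recurrence_minimal p (x ^+ 2 - x) _ p_prime _
  (remainder_recurrence xi (node_val_neq0 p_prime x_ge2)) remainder_bounded n.
rewrite lamE remainder0 -exprM mul2n; apply.
by rewrite expr2; apply: le_trans x_ge2 _; rewrite ler_peMl // ltW.
Qed.
End Remainder.

(** * Least common multiples of initial segments *)

Definition lcm_upto (n : nat) : nat := \big[lcmn/1%N]_(1 <= i < n.+1) i.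

Lemma lcm_upto0 : lcm_upto 0 = 1%N.
Proof. by rewrite /lcm_upto big_geq. Qed.

Lemma lcm_uptoS n : lcm_upto n.+1 = lcmn (lcm_upto n) n.+1.
Proof. by rewrite /lcm_upto big_nat_recr. Qed.

Lemma lcm_upto_gt0 n : (0 < lcm_upto n)%N.
Proof. by elim: n => [|n IHn]; rewrite ?lcm_upto0 // lcm_uptoS lcmn_gt0 IHn. Qed.

Lemma dvdn_lcm_upto i n : (0 < i <= n)%N -> (i %| lcm_upto n)%N.
Proof.
move=> /andP[i0]; elim: n => [|n IHn]; first by case: i i0.
rewrite lcm_uptoS leq_eqVlt => /predU1P[->|]; first exact: dvdn_lcmr.
by rewrite ltnS => /IHn h; apply: dvdn_trans h (dvdn_lcml _ _).
Qed.

(** The exponent of q in lcm(1..n) is the number of j >= 1 with q^j <= n.  This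
    form of the statement makes [prod_lcm_upto] an exchange of two sums. *)
Lemma leq_logn_lcm_upto q n j : prime q -> (0 < j)%N ->
  (j <= logn q (lcm_upto n))%N = (q ^ j <= n)%N.
Proof.
move=> qp j0; have qj : (0 < q ^ j)%N by rewrite expn_gt0 prime_gt0.
apply/idP/idP; last first.
  by move=> qn; rewrite -pfactor_dvdn ?lcm_upto_gt0 // dvdn_lcm_upto // qj.
elim: n => [|n IHn]; first by rewrite lcm_upto0 logn1 leqNgt j0.
rewrite lcm_uptoS logn_lcm ?lcm_upto_gt0 // leq_max => /orP[/IHn h|].
  exact: leq_trans h _.
by rewrite -pfactor_dvdn // => /dvdn_leq; apply.
Qed.

Lemma sum_leq_nat t n : (t <= n)%N -> (\sum_(1 <= k < n.+1) (k <= t)%N = t)%N.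
Proof.
move=> tn; rewrite (big_cat_nat (n := t.+1)) //= [X in (_ + X)%N]big_nat_cond.
rewrite [X in (_ + X)%N]big1 => [|k /andP[/andP[tk _] _]]; last by rewrite leqNgt tk.
rewrite addn0 (eq_big_nat _ _ (F2 := fun=> 1%N)) => [|k /andP[_]]; last by rewrite ltnS => ->.
by rewrite sum_nat_const_nat muln1 subn1.
Qed.

(** Chebyshev's identity log n! = sum_k psi(n/k).  For each prime q both sides count
    the pairs (k, j) with j >= 1 and k q^j <= n. *)
Lemma prod_lcm_upto n : (\prod_(1 <= k < n.+1) lcm_upto (n %/ k) = n`!)%N.
Proof.
have lp q (f : nat -> nat) m : (forall k, 0 < f k)%N ->
    logn q (\prod_(1 <= k < m.+1) f k) = (\sum_(1 <= k < m.+1) logn q (f k))%N.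
  move=> f0; elim: m => [|m IHm]; first by rewrite !big_geq // logn1.
  rewrite big_nat_recr //= lognM //; first by rewrite IHm [RHS]big_nat_recr.
  by rewrite prodn_cond_gt0.
apply: eqn_from_log => [||q]; rewrite ?fact_gt0 //.
  by rewrite prodn_cond_gt0 // => k _; apply: lcm_upto_gt0.
rewrite lp; last by move=> k; apply: lcm_upto_gt0.
case: (boolP (prime q)) => [qp|nq]; last first.
  by rewrite lognE (negPf nq) big1 // => k _; rewrite lognE (negPf nq).
rewrite logn_fact //.
transitivity (\sum_(1 <= k < n.+1) \sum_(1 <= j < n.+1) (k <= n %/ q ^ j))%N.
  apply: eq_big_nat => k /andP[k0 _].
  have ln : (logn q (lcm_upto (n %/ k)) <= n)%N.
    case: (posnP (logn q (lcm_upto (n %/ k)))) => [->//|l0].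
    have := leqnn (logn q (lcm_upto (n %/ k))); rewrite leq_logn_lcm_upto // => h.
    apply: leq_trans (leq_trans h (leq_div _ _)).
    by apply: ltnW; apply: ltn_expl; apply: prime_gt1.
  rewrite -[LHS](sum_leq_nat ln); apply: eq_big_nat => j /andP[j0 _].
  rewrite leq_logn_lcm_upto // !leq_divRL ?expn_gt0 ?(prime_gt0 qp) //.
  by rewrite mulnC.
rewrite exchange_big_nat; apply: eq_big_nat => j _.
by rewrite sum_leq_nat // leq_div.
Qed.

(** In Leibniz's harmonic triangle, with the 1/(j C(j+l,j)) of a given j + l in one
    row, each entry is the one above it minus its neighbour nearer to the edge
    l = 0, and the entries 1/j of that edge have denominators at most n. *)
Lemma leibniz_triangle_int n j l : (0 < j)%N -> (j + l <= n)%N ->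
  (lcm_upto n)%:R / (j * 'C(j + l, j))%:R \is a @Num.int rat.
Proof.
elim: l j => [|l IHl] j j0 jn.
  have /dvdnP[q ->] : (j %| lcm_upto n)%N by apply: dvdn_lcm_upto; rewrite j0 -[j]addn0.
  by rewrite addn0 binn muln1 natrM mulfK ?rpred_nat // pnatr_eq0 -lt0n.
have h1 := IHl j j0 (leq_trans (leq_add (leqnn j) (leqnSn l)) jn).
have h2 : (lcm_upto n)%:R / (j.+1 * 'C(j.+1 + l, j.+1))%:R \is a @Num.int rat.
  by apply: IHl => //; rewrite addSnnS.
suff -> : (lcm_upto n)%:R / (j * 'C(j + l.+1, j))%:R =
  (lcm_upto n)%:R / (j * 'C(j + l, j))%:R
  - (lcm_upto n)%:R / (j.+1 * 'C(j.+1 + l, j.+1))%:R :> rat by rewrite rpredB.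
have B0 : 'C(j + l, j)%:R != 0 :> rat by rewrite pnatr_eq0 -lt0n bin_gt0 leq_addr.
have jr : j%:R != 0 :> rat by rewrite pnatr_eq0 -lt0n.
have e1 : (j.+1 * 'C(j.+1 + l, j.+1) = (j + l).+1 * 'C(j + l, j))%N.
  by rewrite addSn mul_bin_diag.
have e2 : (l.+1 * 'C(j + l.+1, j) = (j + l).+1 * 'C(j + l, j))%N.
  have := mul_bin_left (j + l).+1 j; have /= <- := mul_bin_diag (j + l).+1 j.
  by rewrite addnS subSn ?leq_addr // addKn => ->.
have e2r : 'C(j + l.+1, j)%:R = (j + l).+1%:R * 'C(j + l, j)%:R / l.+1%:R :> rat.
  by rewrite -natrM -e2 natrM mulrC mulKf // pnatr_eq0.
rewrite e1 !natrM e2r.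
have l0 : l.+1%:R != 0 :> rat by rewrite pnatr_eq0.
have jl0 : (j + l).+1%:R != 0 :> rat by rewrite pnatr_eq0.
move: jl0; rewrite -addnS natrD; move: l0; move: (l.+1%:R : rat) => L L0 jL0.
by field; rewrite B0 jr L0 jL0.
Qed.

(** * Denominators of the remainders *)

(** A common denominator of the binomial coefficients C(b/F, m) for all integers b
    and all m <= n. *)
Definition binom_denom (F n : nat) : nat := (F ^ n * n`!`_\pi(F))%N.

(** Modulo M the number F is invertible, so the progression b - iF is F times a run
    of m consecutive integers, whose product is divisible by m!, a multiple
    of M. *)
Lemma int_falling_dvd (F m M : nat) (b : int) : coprime F M -> (0 < M)%N ->
  (M %| m`!)%N -> (M%:Z %| \prod_(i < m) (b - i%:Z * F%:Z))%Z.
Proof.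
move=> FM M0 Mm.
have [c [t [cm ->]]] : exists c : nat, exists t : int, (m <= c)%N /\ b = c%:Z * F%:Z + t * M%:Z.
  have gFM : gcdn F M = 1%N by apply/eqP.
  have [u [v uv]] := Bezoutz F%:Z M%:Z.
  have {}uv : u * F%:Z + v * M%:Z = 1 by rewrite uv /gcdz !absz_nat gFM.
  (* Adding a large multiple of M to the Bezout coefficient makes the run c, c-1, ...,
     c-m+1 nonnegative. *)
  pose q := b * u; pose s : int := (`|q|%N + m)%:Z.
  have c0 : m%:Z <= q + s * M%:Z.
    have : s <= s * M%:Z by rewrite ler_peMr // lez_nat.
    rewrite /s; lia.
  exists (absz (q + s * M%:Z)), (b * v - s * F%:Z); split; first lia.
  rewrite gez0_abs; last by apply: le_trans c0.
  rewrite /q -[b in LHS]mulr1 -uv; ring.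
have -> : (M%:Z %| \prod_(i < m) (c%:Z * F%:Z + t * M%:Z - i%:Z * F%:Z))%Z
        = (M%:Z %| \prod_(i < m) ((c%:Z - i%:Z) * F%:Z))%Z.
  rewrite -(subrK (\prod_(i < m) ((c%:Z - i%:Z) * F%:Z))
             (\prod_(i < m) (c%:Z * F%:Z + t * M%:Z - i%:Z * F%:Z))).
  apply: rpredDl; elim: (m) => [|k IHk]; first by rewrite !big_ord0 subrr dvdz0.
  rewrite !big_ord_recr /=; set P := \prod_(i < k) _ in IHk *; set Q := \prod_(i < k) _ in IHk *.
  have -> : P * (c%:Z * F%:Z + t * M%:Z - k%:Z * F%:Z) - Q * ((c%:Z - k%:Z) * F%:Z)
    = (P - Q) * ((c%:Z - k%:Z) * F%:Z) + P * t * M%:Z by ring.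
  by apply: rpredD; [exact: dvdz_mulr|apply: dvdz_mull; exact: dvdzz].
rewrite big_split /= dvdz_mulr //.
have -> : \prod_(i < m) (c%:Z - i%:Z) = (c ^_ m)%:Z.
  rewrite ffact_prod -[RHS]natz natr_prod; apply: eq_bigr => i _; rewrite natz.
  by rewrite -subzn // (leq_trans _ cm) // ltnW.
by rewrite dvdzE /= (dvdn_trans Mm) // -bin_ffact dvdn_mull.
Qed.

(** Split m! into its part at the primes dividing F, which binom_denom contains, and
    its part prime to F, which divides the numerator by [int_falling_dvd]. *)
Lemma binom_denom_int (F n m : nat) (b : int) : (0 < F)%N -> (m <= n)%N ->
  (binom_denom F n)%:R * (\prod_(i < m) (b%:~R / F%:R - i%:R) / m`!%:R) \is a @Num.int rat.
Proof.
move=> F0 mn.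
have Fr : F%:R != 0 :> rat by rewrite pnatr_eq0 -lt0n.
pose M := (m`!`_(\pi(F)^'))%N; pose P := (m`!`_\pi(F))%N.
have M0 : (0 < M)%N by apply: part_gt0.
have P0 : (0 < P)%N by apply: part_gt0.
have FM : coprime F M.
  by apply: (@pnat_coprime \pi(F)); rewrite ?pnat_pi ?part_pnat.
have /dvdzP[z ez] := int_falling_dvd b FM M0 (dvdn_part _ _).
have -> : \prod_(i < m) (b%:~R / F%:R - i%:R) = z%:~R * M%:R / F%:R ^+ m :> rat.
  have -> : z%:~R * M%:R = (z * M%:Z)%:~R :> rat by rewrite intrM.
  rewrite -ez rmorph_prod -[m in F%:R ^+ m]card_ord -prodr_const -prodf_div.
  by apply: eq_bigr => i _; rewrite rmorphB rmorphM /= -!pmulrn; field.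
have /dvdnP[y ey] : (P %| n`!`_\pi(F))%N by apply: partn_dvd; rewrite ?fact_gt0 ?fact_dvd.
rewrite /binom_denom -(partnC \pi(F) (fact_gt0 m)) -/P -/M ey -(subnK mn) expnD.
rewrite !natrM !natrX.
have Mr : M%:R != 0 :> rat by rewrite pnatr_eq0 -lt0n.
have Pr : P%:R != 0 :> rat by rewrite pnatr_eq0 -lt0n.
set A := F%:R ^+ m; have Ar : A != 0 by rewrite expf_eq0 (negPf Fr) andbF.
set B := F%:R ^+ (n - m).
have -> : B * A * (y%:R * P%:R) * (z%:~R * M%:R / A / (P%:R * M%:R)) = B * y%:R * z%:~R.
  by field; apply/and3P.
by rewrite !rpredM ?rpredX ?rpred_nat ?intr_int.
Qed.

Lemma eq_int (u v : rat) : u = v -> u \is a Num.int -> v \is a Num.int.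
Proof. by move=> ->. Qed.

Definition node_window (x : rat) (j l : nat) : rat :=
  \prod_(i < l) ((x - (j + i).+1%:R) * (x + (j + i)%:R)).

Lemma node_val_window x j l : node_val x (j + l) = node_val x j * node_window x j l.
Proof.
elim: l => [|l IHl]; first by rewrite addn0 /node_window big_ord0 mulr1.
by rewrite addnS node_valS IHl /node_window big_ord_recr /= [RHS]mulrA.
Qed.

(** The window is a product of two generalised binomial coefficients of denominator
    F, up to the sign (-1)^l and the factor l!^2. *)
Lemma node_window_int (F n j l : nat) (a : int) : (0 < F)%N -> (l <= n)%N ->
  (binom_denom F n)%:R ^+ 2 * (node_window (a%:~R / F%:R) j l / l`!%:R ^+ 2)
    \is a @Num.int rat.
Proof.
move=> F0 ln; have Fr : F%:R != 0 :> rat by rewrite pnatr_eq0 -lt0n.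
have h1 := binom_denom_int (a - j.+1%:Z * F%:Z) F0 ln.
have h2 := binom_denom_int (- (a + j%:Z * F%:Z)) F0 ln.
have -> : node_window (a%:~R / F%:R) j l =
   (\prod_(i < l) ((a - j.+1%:Z * F%:Z)%:~R / F%:R - i%:R)) *
   ((-1) ^+ l * \prod_(i < l) ((- (a + j%:Z * F%:Z))%:~R / F%:R - i%:R)).
  rewrite -[l in (-1) ^+ l]card_ord -prodr_const -!big_split /=; apply: eq_bigr => i _.
  by rewrite rmorphB rmorphN rmorphD !rmorphM /= -!pmulrn -!natr1 natrD; field.
have h3 : (-1) ^+ l \is a @Num.int rat by rewrite rpredX // rpredN rpred1.
apply: eq_int (rpredM (rpredM h1 h2) h3); rewrite -[(l`!%:R ^+ 2)^-1]exprVn.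
by move: (\prod_(i < l) _) (\prod_(i < l) _) => A B; ring.
Qed.

(** In the summand N_k(-x)/k!^2 j!^2/N_(j+1)(-x) the quotient of the two N is a
    window of length l = k-j-1.  Dividing it by l!^2 gives binomial coefficients,
    and what remains is (l! j!/k!)^2, the square of an entry
    1/((j+1) C(k,j+1)) of the harmonic triangle. *)
Lemma remainder_int (F n : nat) (a : int) (xi : rat) : (0 < F)%N ->
  (forall j, node_val (a%:~R / F%:R) j != 0) ->
  ((lcm_upto n) * (binom_denom F n))%:R ^+ 2 * (denq xi)%:~R
    * remainder (a%:~R / F%:R) xi n \is a Num.int.
Proof.
move=> F0 v0; set x := a%:~R / F%:R; set d := lcm_upto n; set mu := binom_denom F n.
rewrite /remainder /binomial_sum mulr_sumr rpred_sum // => -[k kn] _ /=.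
rewrite ltnS in kn; rewrite mulrCA rpredM ?rpred_nat // /node_error.
have W0 : mu%:R ^+ 2 * (node_val x k / k`!%:R ^+ 2) \is a @Num.int rat.
  have := node_window_int 0 a F0 kn.
  by rewrite -[k in node_val x k]add0n node_val_window node_val0 mul1r.
rewrite natrM exprMn mulrBr mulrBr rpredB //.
  have -> : d%:R ^+ 2 * mu%:R ^+ 2 * (denq xi)%:~R * (node_val x k / k`!%:R ^+ 2 * xi)
    = d%:R ^+ 2 * (mu%:R ^+ 2 * (node_val x k / k`!%:R ^+ 2)) * ((denq xi)%:~R * xi) by ring.
  have -> : (denq xi)%:~R * xi = (numq xi)%:~R by rewrite numqE mulrC.
  by apply: rpredM; rewrite ?intr_int //; apply: rpredM => //; rewrite rpredX ?rpred_nat.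
rewrite /inverse_factorial_sum !mulr_sumr rpred_sum // => -[j jk] _ /=.
have jk1 : (j.+1 + (k - j.+1))%N = k by rewrite subnKC.
set l := (k - j.+1)%N in jk1.
have ln : (l <= n)%N by rewrite (leq_trans _ kn) // leq_subr.
have h1 := node_window_int j.+1 a F0 ln.
have h2 := @leibniz_triangle_int n j.+1 l isT; rewrite jk1 in h2; have {}h2 := h2 kn.
have kf : k`!%:R = (j.+1 * 'C(k, j.+1))%:R * (j`!%:R * l`!%:R) :> rat.
  by rewrite -(bin_fact jk) -/l factS !natrM; ring.
rewrite -{1}jk1 node_val_window kf.
have c0 : 'C(k, j.+1)%:R != 0 :> rat by rewrite pnatr_eq0 -lt0n bin_gt0.
have h3 : (-1) ^+ j.+1 * (denq xi)%:~R \is a @Num.int rat.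
  by rewrite rpredM ?intr_int // rpredX // rpredN rpred1.
apply: eq_int (rpredM (rpredM (rpredX 2 h2) h1) h3).
field.
by rewrite v0 !fact_rat_neq0 c0 addrC natr1 pnatr_eq0.
Qed.

(** * Logarithms of least common multiples and of factorials *)

Section LogNat.
Context (R : realType).
Implicit Types (m n k : nat).

Lemma ln_natM m n : (0 < m)%N -> (0 < n)%N ->
  ln ((m * n)%:R : R) = ln m%:R + ln n%:R.
Proof. by move=> m0 n0; rewrite natrM lnM // posrE ltr0n. Qed.

Lemma ln_natX m k : (0 < m)%N -> ln ((m ^ k)%:R : R) = k%:R * ln m%:R.
Proof. by move=> m0; rewrite natrX lnXn ?ltr0n // mulr_natl. Qed.

Lemma ln_nat_ge0 n : 0 <= ln (n%:R : R).
Proof. by case: n => [|n]; [rewrite ln0|rewrite ln_ge0 // ler1n]. Qed.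

Lemma ler_ln_nat m n : (0 < m)%N -> (m <= n)%N -> ln (m%:R : R) <= ln n%:R.
Proof.
move=> m0 mn; have n0 := leq_trans m0 mn.
by rewrite ler_ln ?posrE ?ltr0n // ler_nat.
Qed.

Lemma ln_nat_prod (r : seq nat) (f : nat -> nat) : (forall i, 0 < f i)%N ->
  ln ((\prod_(i <- r) f i)%N%:R : R) = \sum_(i <- r) ln (f i)%:R.
Proof.
move=> f0; elim: r => [|i r IHr]; first by rewrite !big_nil ln1.
by rewrite !big_cons ln_natM ?IHr // prodn_gt0.
Qed.

Lemma ln_le_linear (eta y : R) : 0 < eta -> 0 < y -> ln y <= eta * y - ln eta.
Proof.
move=> e0 y0; rewrite lerBrDl -lnM ?posrE //.
by apply: ltW; apply: ln_sublinear; apply: mulr_gt0.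
Qed.

Lemma ln_le_harmonic M : ln (M.+1%:R : R) <= \sum_(1 <= k < M.+1) k%:R^-1.
Proof.
elim: M => [|M IHM]; first by rewrite big_geq // ln1.
rewrite big_nat_recr //=.
have -> : M.+2%:R = M.+1%:R * (1 + M.+1%:R^-1) :> R.
  by rewrite mulrDr mulfV ?pnatr_eq0 // mulr1 natr1.
have i0 : 0 < M.+1%:R^-1 :> R by rewrite invr_gt0 ltr0n.
rewrite lnM ?posrE ?ltr0n //.
by apply: lerD => //; apply: le_ln1Dx; apply: lt_trans i0; rewrite oppr_lt0.
Qed.

Lemma sum_ln_lcm_upto n :
  \sum_(1 <= k < n.+1) ln ((lcm_upto (n %/ k))%:R : R) <= n%:R * ln n%:R.
Proof.
case: n => [|n]; first by rewrite big_geq // mul0r.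
rewrite -(ln_nat_prod _ (f := fun k => lcm_upto (n.+1 %/ k))); last first.
  by move=> k; apply: lcm_upto_gt0.
rewrite prod_lcm_upto -ln_natX //; apply: ler_ln_nat; first exact: fact_gt0.
have -> : (n.+1 ^ n.+1 = \prod_(1 <= i < n.+2) n.+1)%N.
  by rewrite prod_nat_const_nat subn1.
rewrite fact_prod.
by rewrite big_nat [X in (_ <= X)%N]big_nat; apply: leq_prod => i /andP[_]; rewrite ltnS.
Qed.

(** If log d_m > (1 + eps) m for all m > N, then Chebyshev's identity for n = (N+1) M
    gives n log n >= sum_(k <= M) log d_(n/k) >= (1 + eps) (n log M - M), which is
    false for large M. *)
Lemma lcm_upto_small_often (eps : R) N : 0 < eps ->
  exists2 n, (N <= n)%N & ln ((lcm_upto n)%:R : R) <= (1 + eps) * n%:R.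
Proof.
move=> e0; apply: contrapT => none.
have big n : (N < n)%N -> (1 + eps) * n%:R < ln ((lcm_upto n)%:R : R).
  move=> Nn; rewrite ltNge; apply/negP => le; apply: none.
  by exists n => //; apply: ltnW.
set N1 := N.+1%:R : R; have N10 : 0 < N1 by rewrite ltr0n.
(* Chosen so that c < ln M is what the contradiction needs, M being the number of
   terms kept. *)
pose c := (N1 * ln N1 + (1 + eps)) / (eps * N1).
pose M := Num.truncn (expR c).
have cM : c < ln M.+1%:R.
  by rewrite -[c]expRK ltr_ln ?posrE ?expR_gt0 ?ltr0n // truncnS_gt.
pose n := (N.+1 * M.+1)%N.
have Mn : (M.+1 <= n)%N by rewrite /n leq_pmull.
have := sum_ln_lcm_upto n; apply/negP; rewrite -ltNge.
have n0 : (0 < n)%N by [].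
have step : \sum_(1 <= k < M.+2) (1 + eps) * (n%:R / k%:R - 1)
    <= \sum_(1 <= k < n.+1) ln ((lcm_upto (n %/ k))%:R : R).
  rewrite (big_cat_nat (n := M.+2) (p := n.+1)) //= ler_wpDr //.
    by apply: sumr_ge0 => k _; apply: ln_nat_ge0.
  rewrite big_nat [X in _ <= X]big_nat; apply: ler_sum => k /andP[k0 kM].
  have nk : (N < n %/ k)%N.
    by rewrite leq_divRL // /n leq_mul2l /= -ltnS.
  apply: le_trans (ltW (big _ nk)); apply: ler_wpM2l; first by rewrite ltW // addr_gt0.
  rewrite lerBlDr natr1 ler_pdivrMr ?ltr0n // -natrM ler_nat ltnW //.
  by rewrite -ltn_divLR.
apply: lt_le_trans step.
have -> : \sum_(1 <= k < M.+2) (1 + eps) * (n%:R / k%:R - 1)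
   = (1 + eps) * (n%:R * (\sum_(1 <= k < M.+2) k%:R^-1) - M.+1%:R).
  rewrite -mulr_sumr; congr (_ * _); rewrite mulr_sumr sumrB; congr (_ - _).
  by rewrite sumr_const_nat subn1.
apply: (@lt_le_trans _ _ ((1 + eps) * (n%:R * ln M.+1%:R - M.+1%:R))); last first.
  rewrite ler_wpM2l ?lerD2r ?ler_wpM2l //; first by rewrite ltW // addr_gt0.
  apply: le_trans (ln_le_harmonic _); apply: ler_ln_nat => //.
have -> : ln (n%:R : R) = ln N1 + ln M.+1%:R by rewrite ln_natM.
have -> : n%:R = N1 * M.+1%:R :> R by rewrite natrM.
have M0 : 0 < M.+1%:R :> R by rewrite ltr0n.
move: cM; rewrite /c ltr_pdivrMr ?mulr_gt0 // => cM.
rewrite -subr_gt0.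
have -> : (1 + eps) * (N1 * M.+1%:R * ln M.+1%:R - M.+1%:R)
  - N1 * M.+1%:R * (ln N1 + ln M.+1%:R)
  = M.+1%:R * (ln M.+1%:R * (eps * N1) - (N1 * ln N1 + (1 + eps))) by ring.
by rewrite mulr_gt0 // subr_gt0.
Qed.
End LogNat.

(** Both bounds come from summing q f_(k+1) <= f_k <= q f_(k+1) + q - 1 for
    f_k = floor(n/q^k). *)
Lemma legendre_bounds q n K : (0 < q)%N ->
  let S := (\sum_(1 <= k < K.+1) n %/ q ^ k)%N in
  (q.-1 * S + n %/ q ^ K <= n)%N /\ (n <= n %/ q ^ K + q.-1 * (S + K))%N.
Proof.
move=> q0; elim: K => [|K [IH1 IH2]] /=.
  by rewrite big_geq // expn0 divn1 addn0 !muln0 add0n addn0.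
rewrite big_nat_recr //=; set S := (\sum_(_ <= k < _) _)%N in IH1 IH2 *.
have e : (n %/ q ^ K.+1 = (n %/ q ^ K) %/ q)%N by rewrite expnSr divnMA.
have h3 := ltn_pmod (n %/ q ^ K) q0; have h4 := divn_eq (n %/ q ^ K) q.
rewrite -e in h4; move: IH1 IH2 h3 h4 {e}.
move: S (n %/ q ^ K)%N (n %/ q ^ K.+1)%N (_ %% q)%N => S u v m.
case: q q0 => // q _ /= h1 h2 h3 h4; split; nia.
Qed.

Lemma logn_fact_le q n : prime q -> (q.-1 * logn q n`! <= n)%N.
Proof.
move=> qp; rewrite logn_fact //; have [h _] := @legendre_bounds q n n (prime_gt0 qp).
exact: leq_trans (leq_addr _ _) h.
Qed.

(** Together with [logn_fact_le] this says that (q-1) v_q(n!) = n + O(log n). *)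
Lemma logn_fact_ge q n : prime q -> (0 < n)%N ->
  (n <= q.-1 * (logn q n`! + (trunc_log q n).+1))%N.
Proof.
move=> qp n0; set K := (trunc_log q n).+1; have q1 := prime_gt1 qp.
have qK : (n < q ^ K)%N by apply: trunc_log_ltn.
have Kn : (K <= n)%N.
  by apply: leq_trans (trunc_logP q1 n0); apply: ltn_expl.
have [_] := @legendre_bounds q n K (prime_gt0 qp).
rewrite divn_small // add0n => h; apply: leq_trans h _.
rewrite leq_mul2l leq_add2r logn_fact // [X in (_ <= X)%N](big_cat_nat (n := K.+1)) //=.
by rewrite leq_addr orbT.
Qed.

Lemma pi_part_prod F n : (0 < n)%N ->
  (n`_\pi(F) = \prod_(q <- primes F) q ^ logn q n)%N.
Proof.
move=> n0; pose m := maxn n F.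
rewrite (@widen_partn m) ?leq_maxl // -big_filter; apply: perm_big.
apply: uniq_perm; rewrite ?filter_uniq ?iota_uniq ?primes_uniq // => q.
rewrite mem_filter mem_index_iota /= andb_idr // => qF.
rewrite ltnS leq_max; apply/orP; right.
by move: qF; rewrite mem_primes => /and3P[_ F0 /dvdn_leq]; apply.
Qed.

(** * Comparison of the real and the p-adic size of the remainders *)

Section RationalValue.
Context (p : nat) (a : int) (F r : nat) (xi : rat).
Hypotheses (p_prime : prime p) (pa : ~~ (p%:Z %| a)%Z) (F_gt0 : (0 < F)%N).
Hypotheses (pF : (p %| F)%N) (F_abs : padic_abs p F%:R = p%:R ^- r).
Local Notation x := (a%:~R / F%:R : rat).

Lemma padic_abs_argument : padic_abs p x = p%:R ^+ r.
Proof.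
have a0 : a != 0 by apply: contraNneq pa => ->; rewrite dvdz0.
rewrite padic_absM padic_absV F_abs invrK padic_abs_intr //.
rewrite -[RHS]mul1r; congr (_ * _); apply/eqP; rewrite invr_eq1.
suff -> : logn p `|a| = 0%N by [].
by apply/eqP; rewrite -leqn0 -ltnS ltnNge -pfactor_dvdn ?absz_gt0 // expn1; move: pa; rewrite dvdzE.
Qed.

Lemma padic_abs_argument_ge2 : 2 <= padic_abs p x.
Proof.
rewrite padic_abs_argument -natrX ler_nat.
have r0 : (0 < r)%N.
  rewrite lt0n; apply: contraTneq pF => r0; move: F_abs; rewrite r0 expr0 invr1.
  rewrite padic_abs_natr // => /eqP; rewrite invr_eq1 -natrX pnatr_eq1.
  rewrite -[1%N](expn0 p) eqn_exp2l ?prime_gt1 // => /eqP lF.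
  by rewrite -[p in (p %| _)%N]expn1 pfactor_dvdn // lF.
by apply: leq_trans (prime_gt1 p_prime) _; rewrite -[p in (p <= _)%N]expn1 leq_exp2l // prime_gt1.
Qed.

Lemma logn_binom_denom m : logn p (binom_denom F m) = (r * m + logn p m`!)%N.
Proof.
have F_logn : logn p F = r.
  move: F_abs; rewrite padic_abs_natr // => /invr_inj/eqP.
  by rewrite -!natrX eqr_nat eqn_exp2l ?prime_gt1 // => /eqP.
rewrite /binom_denom lognM ?expn_gt0 ?F_gt0 ?part_gt0 // lognX F_logn mulnC.
congr (_ + _)%N; rewrite -logn_part -[RHS]logn_part partn_part // => q.
by rewrite !inE => /eqP ->; rewrite mem_primes p_prime F_gt0 pF.
Qed.

Hypothesis Theta_xi : Theta p a F = ratr xi.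

Let v0 j : node_val x j != 0.
Proof. exact: node_val_neq0 padic_abs_argument_ge2 _. Qed.

Let R := remainder x xi.

(** The inequality 1 <= |z|_p |z| for the nonzero integer z obtained by clearing the
    denominator of R_m.  The exponent collects 2 (r m + v_p(m!)) from R_m and as
    much again from the square of binom_denom. *)
Lemma remainder_padic_real : exists B K, (0 < B)%N /\ forall m, R m != 0 ->
  (p ^ (4 * (r * m + logn p m`!))
    <= B * m.+1 ^ K * (lcm_upto m * binom_denom F m) ^ 2)%N.
Proof.
have p_gt0 : (0 < p)%N := prime_gt0 p_prime.
have [C [K RC]] := theta_recurrence_growth (remainder_recurrence xi v0).
pose c : rat := padic_abs p xi * `|(denq xi)%:~R| * C.
pose B := (Num.truncn c).+1; exists B, K; split=> // m Rm.
set E := (r * m + logn p m`!)%N; set D := (lcm_upto m * binom_denom F m)%N.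
have D0 : (0 < D)%N.
  by rewrite muln_gt0 lcm_upto_gt0 /binom_denom muln_gt0 expn_gt0 F_gt0 part_gt0.
have pE : 0 < p%:R ^+ E :> rat by rewrite exprn_gt0 // ltr0n.
have small : padic_abs p (R m) <= (p%:R ^+ (2 * E))^-1 * padic_abs p xi.
  apply: le_trans (remainder_small p_prime padic_abs_argument_ge2
    (Theta_rational_cvg p_prime padic_abs_argument_ge2 Theta_xi) m) _.
  rewrite padic_abs_argument padic_abs_natr ?fact_gt0 // le_eqVlt; apply/orP; left.
  apply/eqP; congr (_ * _); rewrite exprVn -!exprM -invfM -exprD.
  by congr (_ ^+ _)^-1; rewrite /E -muln2; lia.
have Dabs : padic_abs p D%:R <= (p%:R ^+ E)^-1.
  rewrite padic_abs_natr // lef_pV2 ?posrE ?exprn_gt0 ?ltr0n //.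
  rewrite ler_weXn2l ?ler1n // /D lognM ?lcm_upto_gt0 ?logn_binom_denom ?leq_addl //.
  by move: D0; rewrite muln_gt0 => /andP[].
have [z zE] := intrP (remainder_int m xi F_gt0 v0).
have z0 : z != 0.
  rewrite -(intr_eq0 rat) -zE !mulf_neq0 ?expf_neq0 ?pnatr_eq0 -?lt0n //.
  by rewrite intr_eq0 denq_eq0.
have zabs : padic_abs p z%:~R <= (p%:R ^+ (4 * E))^-1 * padic_abs p xi.
  rewrite -zE padic_absM [padic_abs p (_ ^+ 2 * _)]padic_absM padic_absX.
  have -> : (p%:R ^+ (4 * E))^-1 = (p%:R ^+ E)^-1 ^+ 2 * 1 * (p%:R ^+ (2 * E))^-1 :> rat.
    by rewrite mulr1 exprVn -exprM -invfM -exprD; congr (_ ^+ _)^-1; lia.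
  rewrite -[leRHS]mulrA; apply: ler_pM; [ | exact: padic_abs_ge0 | | exact: small].
    by rewrite mulr_ge0 ?exprn_ge0 ?padic_abs_ge0.
  apply: ler_pM; [ | exact: padic_abs_ge0 | | by rewrite padic_abs_int // intr_int].
    by rewrite exprn_ge0 ?padic_abs_ge0.
  by rewrite lerXn2r ?nnegrE ?padic_abs_ge0 // invr_ge0 ltW.
have zreal : 1 <= padic_abs p z%:~R * `|z%:~R : rat|.
  rewrite padic_abs_intr // mulrC ler_pdivlMr ?exprn_gt0 ?ltr0n // mul1r.
  rewrite -intr_norm -abszE -natrX ler_nat.
  by apply: dvdn_leq; rewrite ?absz_gt0 // pfactor_dvdnn.
have Rreal : `|z%:~R : rat| = D%:R ^+ 2 * `|(denq xi)%:~R| * `|R m|.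
  by rewrite -zE !normrM normr_nat.
rewrite -(ler_nat rat) natrX natrM [(D ^ 2)%:R]natrX natrM [(m.+1 ^ K)%:R]natrX.
apply: (@le_trans _ _ (c * m.+1%:R ^+ K * D%:R ^+ 2)); last first.
  rewrite ler_wpM2r ?exprn_ge0 // ler_wpM2r ?exprn_ge0 //.
  by apply: ltW; apply: truncnS_gt.
have p4 : 0 < p%:R ^+ (4 * E) :> rat by rewrite exprn_gt0 // ltr0n.
have : 1 <= (p%:R ^+ (4 * E))^-1 * padic_abs p xi
    * (D%:R ^+ 2 * `|(denq xi)%:~R| * (C * m.+1%:R ^+ K)).
  apply: le_trans zreal _; rewrite Rreal.
  have DR0 : 0 <= D%:R ^+ 2 * `|(denq xi)%:~R : rat| by rewrite mulr_ge0 ?exprn_ge0.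
  apply: ler_pM; [exact: padic_abs_ge0 | exact: mulr_ge0 | exact: zabs | exact: ler_wpM2l].
rewrite -(ler_pM2l p4) mulr1 !mulrA mulfV ?gt_eqF // mul1r => h.
by apply: le_trans h _; rewrite /c le_eqVlt; apply/orP; left; apply/eqP; ring.
Qed.
End RationalValue.

(** * Irrationality *)

Lemma pred_natr_gt0 (R : realType) q : prime q -> 0 < q%:R - 1 :> R.
Proof. by move=> /prime_gt1 q1; rewrite subr_gt0 ltr1n. Qed.

Lemma ln_fact_valuation_le (R : realType) q n : prime q ->
  (logn q n`!)%:R * ln (q%:R : R) <= n%:R * (ln q%:R / (q%:R - 1)).
Proof.
move=> qp; have q0 := pred_natr_gt0 R qp.
rewrite mulrA ler_pdivlMr // mulrAC ler_wpM2r ?ln_nat_ge0 //.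
have := logn_fact_le n qp; rewrite -(ler_nat R) natrM -subn1 natrB ?prime_gt0 //.
by rewrite mulrC.
Qed.

Lemma ln_fact_valuation_ge (R : realType) q n : prime q -> (0 < n)%N ->
  n%:R * (ln q%:R / (q%:R - 1)) - ln n%:R - ln q%:R
    <= (logn q n`!)%:R * ln (q%:R : R).
Proof.
move=> qp n0; have q0 := pred_natr_gt0 R qp; have q1 := prime_gt1 qp.
have := logn_fact_ge qp n0; rewrite -(ler_nat R) natrM -subn1 natrB ?prime_gt0 //.
rewrite natrD -[(trunc_log q n).+1%:R]natr1.
set v := (logn q n`!)%:R; set k := (trunc_log q n)%:R => h.
have kn : k * ln (q%:R : R) <= ln n%:R.
  by rewrite -ln_natX ?prime_gt0 // ler_ln_nat ?expn_gt0 ?prime_gt0 // trunc_logP.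
have : n%:R * (ln q%:R / (q%:R - 1)) <= (v + (k + 1)) * ln (q%:R : R).
  rewrite mulrA ler_pdivrMr // mulrAC ler_wpM2r ?ln_nat_ge0 //.
  by rewrite mulrC.
lra.
Qed.

Lemma ln_binom_denom_le (R : realType) F n : (0 < F)%N ->
  ln ((binom_denom F n)%:R : R)
    <= n%:R * (ln F%:R + \sum_(q <- primes F) ln q%:R / (q%:R - 1)).
Proof.
move=> F0; rewrite /binom_denom ln_natM ?expn_gt0 ?F0 ?part_gt0 // ln_natX // mulrDr.
rewrite lerD2l pi_part_prod ?fact_gt0 // ln_nat_prod; last by move=> q; apply: pfactor_gt0.
rewrite mulr_sumr big_seq [leRHS]big_seq; apply: ler_sum => q.
rewrite mem_primes => /and3P[qp _ _].
by rewrite ln_natX ?prime_gt0 // ln_fact_valuation_le.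
Qed.

Lemma lcm_upto_leq m n : (m <= n)%N -> (lcm_upto m <= lcm_upto n)%N.
Proof.
elim: n => [|n IHn]; first by rewrite leqn0 => /eqP ->.
rewrite leq_eqVlt => /predU1P[->//|]; rewrite ltnS => /IHn h.
by apply: leq_trans h _; rewrite dvdn_leq ?lcm_upto_gt0 // lcm_uptoS dvdn_lcml.
Qed.

Theorem theorem7p2 (R : realType) (p : nat) (a : int) (F r : nat) :
  prime p ->
  ~~ (p%:Z %| a)%Z ->
  (0 < F)%N ->
  (p %| F)%N ->
  padic_abs p F%:R = p%:R ^- r ->
  ln (F%:R : R) + \sum_(q <- primes F) ln q%:R / (q%:R - 1) + 1
    < 2 * r%:R * ln p%:R + 2 * (ln p%:R / (p%:R - 1)) ->
  forall x : rat, Theta p a F <> ratr x.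
Proof.
move=> pp pa F0 pF Fabs gap xi Txi.
have [B [K [B0 key]]] := remainder_padic_real pp pa F0 pF Fabs Txi.
have x2 := padic_abs_argument_ge2 pp pa F0 pF Fabs.
have rec := remainder_recurrence xi (node_val_neq0 pp x2).
set Rm := remainder _ xi in rec key.
set S := \sum_(q <- primes F) _ in gap; set l := ln (p%:R : R) in gap.
set L := l / (p%:R - 1) in gap; set f := ln (F%:R : R) in gap.
pose del := 2 * r%:R * l + 2 * L - (f + S + 1).
have del0 : 0 < del by rewrite subr_gt0.
have bound m : (0 < m)%N -> Rm m != 0 ->
    4 * (r%:R * m%:R * l + (m%:R * L - ln m%:R - l))
      <= ln B%:R + K%:R * ln m.+1%:R + 2 * (ln (lcm_upto m)%:R + m%:R * (f + S)) :> R.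
  move=> m0 Rm0; have d0 := lcm_upto_gt0 m.
  have mu0 : (0 < binom_denom F m)%N by rewrite muln_gt0 expn_gt0 F0 part_gt0.
  have hmu := ln_binom_denom_le R m F0; rewrite -/S -/f in hmu.
  have hv := ln_fact_valuation_ge R pp m0; rewrite -/l -/L in hv.
  have pE : (0 < p ^ (4 * (r * m + logn p m`!)))%N by rewrite expn_gt0 prime_gt0.
  have := ler_ln_nat R pE (key m Rm0).
  move: (binom_denom F m) (lcm_upto m) mu0 d0 hmu => mu d mu0 d0 hmu.
  have dm0 : (0 < d * mu)%N by rewrite muln_gt0 d0.
  have m1K : (0 < m.+1 ^ K)%N by rewrite expn_gt0.
  have BmK : (0 < B * m.+1 ^ K)%N by rewrite muln_gt0 B0.
  rewrite (ln_natM _ BmK) ?expn_gt0 ?dm0 // (ln_natM _ B0 m1K) !ln_natX ?(prime_gt0 pp) //.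
  rewrite (ln_natM _ d0 mu0) natrM natrD natrM -/l => h.
  have := mulrDl (r%:R * m%:R) (logn p m`!)%:R l; lra.
(* The logarithmic terms K ln (m+1) + 4 ln m are to cost at most (del/2) m,
   up to a constant. *)
pose eta := del / (2 * (K%:R + 4)).
have K4 : 0 < K%:R + 4 :> R by rewrite ltr_wpDl.
have eta0 : 0 < eta by rewrite divr_gt0 // mulr_gt0.
pose c := ln B%:R + 4 * l + (K%:R + 4) * (eta - ln eta) + 2 * (1 + del / 4).
pose N := (Num.truncn (c / del)).+2.
have [n Nn dn] := @lcm_upto_small_often R (del / 4) N (divr_gt0 del0 (ltr0n _ 4)).
(* The bound on the lcm at n is also good for n - 1, and one of the two remainders
   is nonzero. *)
have [m [m1 m2 Rm0]] : exists m, [/\ (m <= n)%N, (n <= m.+1)%N & Rm m != 0].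
  case: n Nn dn => // n _ _; have /orP[h|h] := theta_recurrence_neq0 n rec.
    by exists n.
  by exists n.+1.
have Nm : (Num.truncn (c / del) < m)%N by rewrite -ltnS (leq_trans Nn).
have m0 : (0 < m)%N by apply: leq_ltn_trans Nm.
have cm : c < del * m%:R.
  rewrite mulrC -ltr_pdivrMr //; apply: lt_le_trans (truncnS_gt _) _.
  by rewrite ler_nat.
have dm : ln (lcm_upto m)%:R <= (1 + del / 4) * (m%:R + 1) :> R.
  apply: le_trans (ler_ln_nat R (lcm_upto_gt0 m) (lcm_upto_leq m1)) _.
  apply: le_trans dn _; rewrite natr1 ler_wpM2l ?ler_nat //.
  by rewrite addr_ge0 // divr_ge0 // ltW.
have lm : ln m.+1%:R <= eta * (m%:R + 1) - ln eta :> R.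
  by rewrite natr1; apply: ln_le_linear; rewrite // ltr0n.
have lm' : ln m%:R <= ln m.+1%:R :> R by apply: ler_ln_nat.
have := bound m m0 Rm0.
have eK : (K%:R + 4) * eta = del / 2 by rewrite /eta; field; rewrite gt_eqF.
have h1 : K%:R * ln m.+1%:R + 4 * ln m%:R
    <= del / 2 * m%:R + (K%:R + 4) * (eta - ln eta) :> R.
  rewrite -eK; apply: (@le_trans _ _ ((K%:R + 4) * (eta * (m%:R + 1) - ln eta))).
    apply: (@le_trans _ _ ((K%:R + 4) * ln m.+1%:R)); first by lra.
    by rewrite ler_wpM2l // ltW.
  by rewrite le_eqVlt; apply/orP; left; apply/eqP; ring.
move: cm dm h1; rewrite /c /del; nra.
Qed.
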